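(* For any pair $(t, \delta)$ of positive integers there exists a non-factorial hypersurface $X \subset \mathbb{P}^4$ of degree $d$ with $k$ ordinary $m$-ple points as only singularities, where $$d = \delta t + 1, \qquad k = \delta^2, \qquad m = t + 1.$$
   Context: All varieties are over $\mathbb{C}$. A point $p$ of a hypersurface $X \subset \mathbb{P}^4$ is an ordinary $m$-ple point if the tangent cone of $X$ at $p$ is a cone over a smooth surface of degree $m$ in $\mathbb{P}^3$. A projective variety $X \subset \mathbb{P}^4$ is factorial if its homogeneous coordinate ring $\mathbb{C}[x_0,\ldots,x_4]/I_X$ is a unique factorization domain; otherwise it is non-factorial. *)

(* Defs.v *)
From HB Require Import structures.
From mathcomp Require Import all_boot all_order all_algebra.
From mathcomp Require Import ring_quotient.
From mathcomp Require Import boolp reals.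
From mathcomp Require Import complex.
From mathcomp Require Import mpoly.

Set Implicit Arguments.
Unset Strict Implicit.
Unset Printing Implicit Defensive.

Import GRing.Theory.
Local Open Scope ring_scope.

(* The field of complex numbers is [R[i]] for [R : realType].  A point of P^n
   is represented by a nonzero row vector of length n.+1, up to [same_point];
   a subset of P^n is represented by the predicate of its affine cone. *)

Section UniqueFactorization.
Variable A : comNzRingType.

Definition invertible (x : A) := exists y, x * y = 1.

Definition irreducible_elt (x : A) :=
  [/\ x != 0, ~ invertible x
    & forall a b, x = a * b -> invertible a \/ invertible b].

Definition associated (x y : A) := exists2 u, invertible u & y = u * x.

Definition is_domain := forall x y : A, x * y = 0 -> x = 0 \/ y = 0.

Definition has_factorizations :=
  forall x : A, x != 0 -> ~ invertible x ->
  exists2 s : seq A, {in s, forall q, irreducible_elt q} & x = \prod_(q <- s) q.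

Definition unique_factorizations :=
  forall s1 s2 : seq A,
  {in s1, forall q, irreducible_elt q} ->
  {in s2, forall q, irreducible_elt q} ->
  \prod_(q <- s1) q = \prod_(q <- s2) q ->
  exists s : seq A,
    [/\ perm_eq s s2, size s1 = size s
      & forall k, (k < size s1)%N -> associated s1`_k s`_k].

Definition is_ufd :=
  [/\ is_domain, has_factorizations & unique_factorizations].

End UniqueFactorization.

Section ProjectiveGeometry.
Variables (R : realType) (n : nat).
Local Notation C := R[i].
Implicit Types (X : 'rV[C]_n.+1 -> Prop) (f g : {mpoly C[n.+1]}).
Implicit Types (u v : 'rV[C]_n.+1).

Definition same_point u v := exists2 c : C, c != 0 & v = c *: u.

Definition zero_set f : 'rV[C]_n.+1 -> Prop := fun v => f.@[v 0] = 0.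

Definition vanishes_on X g := forall v, v != 0 -> X v -> g.@[v 0] = 0.

Definition has_point X := exists2 v, v != 0 & X v.

(* The proof [hX] is used only to make the ideal proper, as required by the
   quotient construction. *)
Definition vanishing_ideal X (hX : has_point X) : {pred {mpoly C[n.+1]}} :=
  fun g => `[< vanishes_on X g >].

Lemma vanishing_idealP X (hX : has_point X) : idealr_closed (vanishing_ideal hX).
Proof.
split.
- by apply/asboolP => v _ _; rewrite meval0.
- by apply/negP => /asboolP; case: hX => v v0 Xv /(_ v v0 Xv) /eqP;
    rewrite meval1 oner_eq0.
- move=> a f g /asboolP hf /asboolP hg; apply/asboolP => v v0 Xv.
  by rewrite mevalD mevalM hf // hg // mulr0 addr0.
Qed.

HB.instance Definition _ X (hX : has_point X) :=
  isIdealr.Build {mpoly C[n.+1]} (vanishing_ideal hX) (vanishing_idealP hX).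

Definition homogeneous_coordinate_ring X (hX : has_point X) : comNzRingType :=
  {ideal_quot (vanishing_ideal hX)}.

(* For X empty the quotient is the zero ring, which is not a UFD. *)
Definition factorial_variety X :=
  exists hX : has_point X, is_ufd (homogeneous_coordinate_ring hX).

(* [f] is a form of degree [d] generating the ideal of the hypersurface it
   defines; in particular [f] is reduced. *)
Definition hypersurface_equation (d : nat) f :=
  [/\ (0 < d)%N, f != 0, f \is d.-homog
    & forall g, vanishes_on (zero_set f) g <-> exists h, g = h * f].

Definition singular_point f v :=
  [/\ v != 0, zero_set f v & forall i : 'I_n.+1, (f^`M(i)).@[v 0] = 0].

Definition smooth_hypersurface_equation (d : nat) f :=
  hypersurface_equation d f /\ forall v, ~ singular_point f v.

(* Equation of the hypersurface f = 0 in the standard chart x_i <> 0, with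
   coordinates x_j / x_i translated so that the point v is the origin. *)
Definition local_equation f v (i : 'I_n.+1) : {mpoly C[n]} :=
  f \mPo [tuple if unlift i j is Some l then 'X_l + (v 0 j / v 0 i)%:MP else 1
         | j < n.+1].

(* The monomial order is graded, so [mlast F] has least degree in the support
   of [F]. *)
Definition initial_form (F : {mpoly C[n]}) : {mpoly C[n]} :=
  pihomog mdeg (mdeg (mlast F)) F.

Definition tangent_cone f v i := initial_form (local_equation f v i).

End ProjectiveGeometry.

(* The tangent cone is independent, up to a linear change of coordinates, of
   the chart x_i <> 0 containing the point. *)
Definition ordinary_point (R : realType) (m : nat) (f : {mpoly R[i][5]})
    (v : 'rV[R[i]]_5) :=
  [/\ v != 0, zero_set f v
    & exists2 i : 'I_5, v 0 i != 0
      & @smooth_hypersurface_equation R 3 m (@tangent_cone R 4 f v i)].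

(* Main.v *)
Require Import Defs.
From HB Require Import structures.
From mathcomp Require Import all_boot all_order all_algebra.
From mathcomp Require Import generic_quotient ring_quotient cyclic separable cyclotomic.
From mathcomp Require Import boolp reals complex mpoly.
From mathcomp Require Import zify ring.

Set Implicit Arguments.
Unset Strict Implicit.
Unset Printing Implicit Defensive.

Import GRing.Theory Num.Theory.
Local Open Scope ring_scope.

(** In coordinates (w : y : z : v : u) the hypersurface is
      u B(w,y,u) + c v B(w,z,v) = 0, where
      B(w,y,x) = (y^delta - w^delta)^t + x^t w^((delta-1)t) + x^(delta t)
    and c is a general constant.  It contains the plane u = v = 0, on which
    the cofactors of u and v restrict, up to c, to the t-th powers of
    y^delta - w^delta and z^delta - w^delta.  These vanish together at the
    delta^2 points (1 : zeta : zeta' : 0 : 0) with zeta and zeta' among the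
    delta-th roots of unity, and there both cofactors have multiplicity t.

    Singular locus ([weighted_sum_no_singularity]).  The equation is
    g(y,u) + c g(z,v), a sum in separate variables once w = 1, with
    g(y,x) = x B(1,y,x); so a singular point is a pair of critical points of g
    whose critical values a, b satisfy a + c b = 0.  The critical points of g
    are the points (zeta, 0), with value 0, and others whose values form a
    finite set without 0.  Hence, when c avoids finitely many constants, both
    critical points are of the first kind.  On w = 0 the partial derivatives
    of x B(w,y,x) in x and y vanish together only at the origin.

    Tangent cones ([tangent_cone_node]).  Around (1 : zeta : zeta' : 0 : 0) the
    polynomial y^delta - w^delta has a nonzero linear part k y, so the tangent
    cone is u ((k y)^t + kappa u^t) + c v ((l z)^t + kappa v^t), with kappa
    equal to 2 if delta = 1 and to 1 otherwise; it is smooth.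

    The ideal ([separable_fibre_hypersurface]).  A form that does not vanish at
    (0 : ... : 0 : 1) is, up to a constant, monic in the last variable.  If one
    of its fibres over the other variables is separable, its discriminant is a
    nonzero polynomial, so a polynomial of smaller degree in the last variable
    that vanishes on the zero set is zero on almost every fibre, hence zero.
    Division with remainder turns this into the Nullstellensatz needed for the
    threefold and for the tangent cones.

    Factoriality ([linear_section_not_factorial]).  In the coordinate ring
    u B(w,y,u) = v (- c B(w,z,v)).  If the ring is a domain, its grading makes
    the linear form u irreducible, so in a UFD u would divide v or
    B(w,z,v).  It divides neither, because the hyperplane section u = 0 of the
    threefold consists of the plane u = v = 0 and of the residual surface
    u = B(w,z,v) = 0: each of v and B(w,z,v) vanishes on one of them only. *)


(** * Polynomials as polynomials in the last variable *)

Lemma mpoly_rmorph_ext (n : nat) (A : comNzRingType) (S : nzRingType)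
    (f g : {rmorphism {mpoly A[n]} -> S}) :
    (forall c, f c%:MP = g c%:MP) -> (forall i, f 'X_i = g 'X_i) -> f =1 g.
Proof.
move=> eqC eqX p; rewrite [p]mpolyE !rmorph_sum; apply: eq_bigr => m _.
rewrite -mul_mpolyC !rmorphM eqC mpolyXE_id !rmorph_prod; congr (_ * _).
by apply: eq_bigr => i _; rewrite !rmorphXn eqX.
Qed.

Lemma muniX_widen n (A : nzRingType) (i : 'I_n) :
  muni ('X_(widen_ord (leqnSn n) i) : {mpoly A[n.+1]}) = ('X_i)%:P.
Proof.
rewrite muniE msuppX big_seq1 mcoeffX eqxx scale1r.
have -> : (U_(widen_ord (leqnSn n) i) : 'X_{1..n.+1})%MM ord_max = 0%N.
  by rewrite mnm1E -val_eqE /= ltn_eqF.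
rewrite expr0 alg_polyC; congr ('X_[_]%:P); apply/mnmP => j.
by rewrite !mnmE -!val_eqE.
Qed.

Lemma muniX_max n (A : nzRingType) :
  muni ('X_ord_max : {mpoly A[n.+1]}) = 'X.
Proof.
rewrite muniE msuppX big_seq1 mcoeffX eqxx scale1r mnm1E eqxx expr1.
rewrite (_ : [multinom _ | i < n] = 0%MM) ?mpolyX0 ?scale1r //.
by apply/mnmP => j; rewrite !mnmE -val_eqE /= eqn_leq leqNgt ltn_ord.
Qed.

(** The restriction of [p] to the line over [x] parallel to the last axis. *)
Definition fibre n (A : comNzRingType) (x : 'I_n -> A) (p : {mpoly A[n.+1]}) :
  {poly A} := map_poly (meval x) (muni p).
HB.instance Definition _ n (A : comNzRingType) (x : 'I_n -> A) :=
  GRing.RMorphism.copy (fibre x) (map_poly (meval x) \o @muni n A).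

Lemma fibreC n (A : comNzRingType) (x : 'I_n -> A) c : fibre x c%:MP = c%:P.
Proof. by rewrite /fibre muniC map_polyC /= mevalC. Qed.

Lemma fibreX n (A : comNzRingType) (x : 'I_n -> A) i :
  fibre x 'X_i = if unlift ord_max i is Some j then (x j)%:P else 'X.
Proof.
rewrite /fibre; case: unliftP => [j ->|->]; last by rewrite muniX_max map_polyX.
have -> : lift ord_max j = widen_ord (leqnSn n) j.
  by apply/val_inj; rewrite /= /bump leqNgt ltn_ord.
by rewrite muniX_widen map_polyC /= mevalXU.
Qed.

Lemma horner_fibre n (A : comNzRingType) (v : 'I_n.+1 -> A) (p : {mpoly A[n.+1]}) :
  (fibre (v \o lift ord_max) p).[v ord_max] = p.@[v].
Proof.
suff: (horner_eval (v ord_max) \o fibre (v \o lift ord_max)) =1 meval v.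
  by move/(_ p).
apply: mpoly_rmorph_ext => [c|i] /=; rewrite /horner_eval.
  by rewrite fibreC hornerC mevalC.
rewrite fibreX mevalXU; case: unliftP => [j ->|->]; first by rewrite hornerC.
by rewrite hornerX.
Qed.

Definition insert_last n (A : Type) (x : 'I_n -> A) (a : A) : 'I_n.+1 -> A :=
  fun i => if unlift ord_max i is Some j then x j else a.

Lemma meval_insert_last n (A : comNzRingType) (x : 'I_n -> A) a (p : {mpoly A[n.+1]}) :
  p.@[insert_last x a] = (fibre x p).[a].
Proof.
rewrite -horner_fibre /insert_last unlift_none; congr (_.[a]).
rewrite /fibre; apply: eq_map_poly => q; apply: meval_eq => i /=.
by rewrite liftK.
Qed.

(** Left inverse of [muni], as a ring morphism. *)
Definition assemble n (A : comNzRingType) (P : {poly {mpoly A[n]}}) :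
  {mpoly A[n.+1]} := (map_poly (@mwiden n A) P).['X_ord_max].
HB.instance Definition _ n (A : comNzRingType) :=
  GRing.RMorphism.copy (@assemble n A)
    (horner_eval ('X_ord_max : {mpoly A[n.+1]}) \o map_poly (@mwiden n A)).

Lemma muniK n (A : comNzRingType) : cancel (@muni n A) (@assemble n A).
Proof.
move=> p; suff: (@assemble n A \o @muni n A) =1 idfun by move/(_ p).
apply: mpoly_rmorph_ext => [c|i] /=; rewrite /assemble.
  by rewrite muniC map_polyC /= mwidenC hornerC.
case: (unliftP ord_max i) => [j ->|->]; last by rewrite muniX_max map_polyX hornerX.
have -> : lift ord_max j = widen_ord (leqnSn n) j.
  by apply/val_inj; rewrite /= /bump leqNgt ltn_ord.
rewrite muniX_widen map_polyC hornerC /= mwidenX; congr 'X_[_].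
exact: mnmwiden1.
Qed.

Lemma poly_vanish_eq0 (F : closedFieldType) (p : {poly F}) :
  (forall a, p.[a] = 0) -> p = 0.
Proof.
move=> p0; apply/eqP; apply: contraT => /closed_nonrootP [a].
by rewrite /root p0 eqxx.
Qed.

Lemma mpoly_vanish_eq0 n (F : closedFieldType) (p : {mpoly F[n]}) :
  (forall x, p.@[x] = 0) -> p = 0.
Proof.
elim: n p => [|n IHn] p p0.
  have := p0 (fun=> 0); rewrite (nvar0_mpolyC p) mevalC => ->; exact: mpolyC0.
suff: muni p = 0 by move/(congr1 (@assemble n F)); rewrite muniK rmorph0.
apply/polyP => i; rewrite coef0; apply: IHn => x.
suff: fibre x p = 0 by move/(congr1 (coefp i)); rewrite /= coef_map coef0.
by apply: poly_vanish_eq0 => a; rewrite -meval_insert_last.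
Qed.

(** A separable polynomial over a closed field is a constant times the product
    of the ['X - a] over its distinct roots. *)
Lemma coprime_deriv_dvdp (F : closedFieldType) (p q : {poly F}) :
    coprimep p p^`() -> (forall a, root p a -> root q a) -> p %| q.
Proof.
move=> sep roots_pq; have [r Dp] := closed_field_poly_normal p.
have [p0|nzp] := eqVneq p 0.
  have q0 : q = 0.
    apply: poly_vanish_eq0 => a; apply/eqP/roots_pq; rewrite p0; exact: root0.
  by rewrite q0 dvdp0.
have c0 : lead_coef p != 0 by rewrite lead_coef_eq0.
rewrite Dp dvdpZl //; apply: uniq_roots_dvdp.
  apply/allP => a ar; apply: roots_pq; rewrite Dp rootZ // root_prod_XsubC //.
rewrite uniq_rootsE -separable_prod_XsubC.
have : separable_poly p by rewrite unlock.
by rewrite Dp !unlock derivZ coprimepZl // coprimepZr.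
Qed.

(** * Forms generating the ideal of their zero set *)

Lemma dhomog_meval_scale n (A : comNzRingType) d (p : {mpoly A[n]}) s
    (v v' : 'I_n -> A) :
  p \is d.-homog -> (forall i, v' i = s * v i) -> p.@[v'] = s ^+ d * p.@[v].
Proof.
move=> /dhomogP hp Dv; rewrite !mevalE mulr_sumr.
rewrite !big_seq; apply: eq_bigr => m /hp <-.
rewrite mulrCA; congr (_ * _); rewrite /= mdegE -prodrXr -big_split /=.
by apply: eq_bigr => i _; rewrite Dv exprMn.
Qed.

Lemma dhomog_meval0 n (A : comNzRingType) d (p : {mpoly A[n]}) v :
  (0 < d)%N -> p \is d.-homog -> (forall i, v i = 0) -> p.@[v] = 0.
Proof.
move=> d_gt0 hp v0.
rewrite (@dhomog_meval_scale _ _ _ _ 0 (fun=> 0) v hp) => [|i].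
  by rewrite expr0n gtn_eqF // mul0r.
by rewrite mul0r v0.
Qed.

Lemma coef_muni_dhomog n (A : nzRingType) d (p : {mpoly A[n.+1]}) i :
  p \is d.-homog -> (i <= d)%N -> (muni p)`_i \is (d - i).-homog.
Proof.
move=> /dhomogP hp le_id; rewrite muniE coef_sum big_seq.
apply: rpred_sum => m /hp Dd.
rewrite coefZ coefXn; case: eqP => [->|_]; last by rewrite mulr0 dhomog0.
rewrite mulr1; apply/dhomogZ; rewrite dhomogX -{}Dd /= [mdeg m]mdegE big_ord_recr /=.
by rewrite addnK mdegE; apply/eqP; apply: eq_bigr => j _; rewrite mnmE.
Qed.

Lemma coef_muni_gt n (A : nzRingType) d (p : {mpoly A[n.+1]}) i :
  p \is d.-homog -> (d < i)%N -> (muni p)`_i = 0.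
Proof.
move=> /dhomogP hp lt_di; rewrite muniE coef_sum big_seq big1 // => m /hp Dd.
rewrite coefZ coefXn; case: eqP => [Di|]; last by rewrite mulr0.
by move: lt_di; rewrite -{}Dd Di /= mdegE big_ord_recr /= ltnNge leq_addl.
Qed.

(** The coefficient of [U^d] is a form of degree 0, that is a constant, and
    this constant is the value at (0, ..., 0, 1). *)
Lemma muni_dhomog_lead n (A : comNzRingType) d (p : {mpoly A[n.+1]}) :
    p \is d.-homog -> p.@[insert_last (fun=> 0) 1] != 0 ->
  size (muni p) = d.+1 /\
  lead_coef (muni p) = (p.@[insert_last (fun=> 0) 1])%:MP.
Proof.
move=> hp nz_p.
have sz_le : (size (muni p) <= d.+1)%N.
  by apply/leq_sizeP => i lt_di; apply: coef_muni_gt hp lt_di.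
have cd : (muni p)`_d = (p.@[insert_last (fun=> 0) 1])%:MP.
  have := coef_muni_dhomog hp (leqnn d); rewrite subnn => h0.
  have Dc : (muni p)`_d = (((muni p)`_d)@_0%MM)%:MP.
    apply: msize1_polyC; rewrite msizeE; apply/bigmax_leqP_seq => m.
    by move/dhomogP: h0 => /[apply] ->.
  rewrite Dc; congr _%:MP; rewrite meval_insert_last.
  have sz_fib : (size (fibre (fun=> 0%R) p) <= d.+1)%N.
    exact: leq_trans (size_poly _ _) sz_le.
  rewrite (horner_coef_wide _ sz_fib) big_ord_recr /= expr1n mulr1.
  rewrite big1 ?add0r => [|i _]; last first.
    rewrite coef_map expr1n mulr1 /=.
    apply: (@dhomog_meval0 _ _ (d - i)) => //; first by rewrite subn_gt0.
    by apply: coef_muni_dhomog hp _; apply: ltnW.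
  by rewrite coef_map /= [in RHS]Dc mevalC.
have sz : size (muni p) = d.+1.
  apply/eqP; rewrite eqn_leq sz_le /=; rewrite ltnNge; apply/negP => sz_le_d.
  by move: cd; rewrite (nth_default 0 sz_le_d) => /eqP; rewrite eq_sym mpolyC_eq0 (negPf nz_p).
by split=> //; rewrite lead_coefE sz.
Qed.

(** As neither leading coefficient is killed, the degrees and hence the size
    of the Sylvester matrix are preserved. *)
Lemma rmorph_resultant (A S : nzRingType) (f : {rmorphism A -> S}) (p q : {poly A}) :
    f (lead_coef p) != 0 -> f (lead_coef q) != 0 ->
  f (resultant p q) = resultant (map_poly f p) (map_poly f q).
Proof.
move=> nz_p nz_q; rewrite /resultant /Sylvester_mx !size_map_poly_id0 //.
rewrite -det_map_mx map_col_mx; congr (\det (col_mx _ _));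
  by apply: map_lin1_mx => v; rewrite map_poly_rV rmorphM /= map_rVpoly.
Qed.

(** Let [D] be the resultant of [muni f] and its derivative. Where [D] does
    not vanish the fibre of [f] is separable, so it divides the fibre of [r],
    which has smaller degree and must be zero. Hence the product of [D],
    ['X_ord0] and any coefficient of [r] vanishes everywhere; the factor
    ['X_ord0] takes care of the fibre over the origin, where nothing is
    assumed. *)
Lemma separable_fibre_eq0 n (F : numClosedFieldType) (f : {mpoly F[n.+2]})
    (x0 : 'I_n.+1 -> F) d a (r : {poly {mpoly F[n.+1]}}) :
    (0 < d)%N -> size (muni f) = d.+1 -> lead_coef (muni f) = a%:MP -> a != 0 ->
    coprimep (fibre x0 f) (fibre x0 f)^`() -> (size r <= d)%N ->
    (forall x s, (exists i, x i != 0) -> root (fibre x f) s ->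
       root (map_poly (meval x) r) s) ->
  r = 0.
Proof.
move=> d_gt0 sz_f lc_f nz_a sep sz_r vanish.
pose P := muni f; pose D := resultant P P^`().
have lcP' : lead_coef P^`() = (a *+ d)%:MP.
  have szP' : (size P^`() <= d)%N by rewrite -ltnS -sz_f lt_size_deriv // -size_poly_eq0 sz_f.
  have cP' : P^`()`_d.-1 = (a *+ d)%:MP.
    by rewrite coef_deriv prednK // mpolyCMn -lc_f lead_coefE sz_f.
  suff Dsz : size P^`() = d by rewrite lead_coefE Dsz.
  apply/eqP; rewrite eqn_leq szP' /= -(prednK d_gt0) ltnNge.
  apply/negP => /(nth_default 0); rewrite cP' => /eqP.
  by rewrite mpolyC_eq0 mulrn_eq0 (negPf nz_a) orbF gtn_eqF.
have DE x : D.@[x] = resultant (fibre x f) (fibre x f)^`().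
  rewrite /D rmorph_resultant /= -?deriv_map // ?lcP' ?lc_f mevalC //.
  by rewrite mulrn_eq0 (negPf nz_a) orbF gtn_eqF.
have D_neq0 : D != 0.
  apply/eqP => D0; have := DE x0; rewrite D0 meval0 => /esym/eqP.
  by rewrite resultant_eq0 => /gtn_eqF; move: sep; rewrite /coprimep => ->.
apply/polyP => i; rewrite coef0.
have : D * (r`_i * 'X_ord0) = 0.
  apply: mpoly_vanish_eq0 => x; rewrite !mevalM mevalXU.
  have [->|Dx] := eqVneq D.@[x] 0; first by rewrite mul0r.
  have [->|x_neq0] := eqVneq (x ord0) 0; first by rewrite !mulr0.
  have nz_x : exists i, x i != 0 by exists ord0.
  have sep_x : coprimep (fibre x f) (fibre x f)^`().
    move: Dx; rewrite DE resultant_eq0 -leqNgt => le1.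
    rewrite /coprimep eqn_leq le1 lt0n size_poly_eq0 gcdp_eq0 negb_and.
    by rewrite map_poly_eq0_id0 ?lc_f ?mevalC // -size_poly_eq0 sz_f.
  have := coprime_deriv_dvdp sep_x (vanish x ^~ nz_x).
  have szx : size (fibre x f) = d.+1.
    by rewrite size_map_poly_id0 // lc_f mevalC.
  have [rx0 _|nz_rx] := eqVneq (map_poly (meval x) r) 0.
    by move/(congr1 (coefp i)): rx0; rewrite /= coef_map coef0 /= => ->; rewrite mul0r mulr0.
  move=> /(dvdp_leq nz_rx); rewrite szx => /leq_trans/(_ (size_poly _ _)).
  by rewrite ltnNge sz_r.
move/eqP; rewrite !mulf_eq0 (negPf D_neq0) /= => /orP[/eqP //|].
by rewrite -msize_poly_eq0 msizeX.
Qed.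

(** The remainder of [g] in the division by [f], which is monic up to a
    constant in the last variable, vanishes wherever [f] does, and
    [separable_fibre_eq0] applies to it. *)
Lemma separable_fibre_dvd (F : numClosedFieldType) n d (f g : {mpoly F[n.+2]})
    (x0 : 'I_n.+1 -> F) :
    (0 < d)%N -> f \is d.-homog -> f.@[insert_last (fun=> 0) 1] != 0 ->
    coprimep (fibre x0 f) (fibre x0 f)^`() ->
    (forall v : 'rV[F]_n.+2, v != 0 -> f.@[v 0] = 0 -> g.@[v 0] = 0) ->
  exists h, g = h * f.
Proof.
move=> d_gt0 hf nz_f sep g0; have [szf lcf] := muni_dhomog_lead hf nz_f.
set a := f.@[_] in lcf nz_f.
pose P := (a^-1)%:MP *: muni f.
have monP : P \is monic.
  by rewrite monicE lead_coefZ lcf -mpolyCM mulVf.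
have Dg := Pdiv.RingMonic.rdivp_eq monP (muni g).
set q := Pdiv.CommonRing.rdivp _ _ in Dg; set r := Pdiv.CommonRing.rmodp _ _ in Dg.
have nz_aV : (a^-1)%:MP_[n.+1] != 0 by rewrite mpolyC_eq0 invr_eq0.
have sz_r : (size r <= d)%N.
  rewrite -ltnS -szf -(size_scale (muni f) nz_aV).
  exact: Pdiv.CommonRing.ltn_rmodpN0 (monic_neq0 monP).
have r0 : r = 0.
  apply: (separable_fibre_eq0 d_gt0 szf lcf nz_f sep sz_r) => x s [i xi] fs.
  have Dgx : fibre x g
      = map_poly (meval x) q * ((a^-1)%:P * fibre x f) + map_poly (meval x) r.
    rewrite /fibre [in LHS]Dg rmorphD rmorphM /P -mul_polyC rmorphM.
    by congr (_ * (_ * _) + _); rewrite /= map_polyC; congr _%:P; exact: mevalC.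
  have : (fibre x g).[s] = 0.
    pose v : 'rV[F]_n.+2 := \row_j insert_last x s j.
    have Dv : v 0 =1 insert_last x s by move=> j; rewrite mxE.
    rewrite -meval_insert_last -(meval_eq _ Dv); apply: g0.
      apply: contra_neq xi => v0; have := Dv (lift ord_max i).
      by rewrite v0 mxE /insert_last liftK.
    by rewrite (meval_eq _ Dv) meval_insert_last; apply/rootP.
  by rewrite Dgx hornerD !hornerM (rootP fs) !mulr0 add0r => /rootP.
exists (assemble q * assemble ((a^-1)%:MP%:P)).
by rewrite -[g]muniK -[f in RHS]muniK -!(rmorphM (@assemble _ _)) Dg r0 addr0
  /P -mul_polyC mulrA.
Qed.

Lemma separable_fibre_hypersurface (R : realType) n d (f : {mpoly R[i][n.+2]})
    (x0 : 'I_n.+1 -> R[i]) :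
    (0 < d)%N -> f \is d.-homog -> f.@[insert_last (fun=> 0) 1] != 0 ->
    coprimep (fibre x0 f) (fibre x0 f)^`() ->
  hypersurface_equation d f.
Proof.
move=> d_gt0 hf nz_f sep.
split=> //; first by apply: contraNneq nz_f => ->; rewrite meval0.
move=> g; split=> [g0|[h ->] v _ fv]; last by rewrite mevalM fv mulr0.
exact: (separable_fibre_dvd d_gt0 hf nz_f sep).
Qed.

(** * Hypersurfaces with a coordinate ring that is not factorial *)

(** By uniqueness [x] appears, up to a unit, in the factorization of [y * b]
    obtained by joining those of [y] and [b]. *)
Lemma irreducible_prime (A : comNzRingType) (x y a b : A) :
    is_ufd A -> irreducible_elt x -> x * a = y * b ->
  (exists k, y = x * k) \/ (exists k, b = x * k).
Proof.
move=> [domA factA uniqA] irrx Exa; have [nz_x _ irr_x] := irrx.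
have invE (z : A) : invertible z \/ ~ invertible z by exact: EM.
have [->|nz_y] := eqVneq y 0; first by left; exists 0; rewrite mulr0.
have [->|nz_b] := eqVneq b 0; first by right; exists 0; rewrite mulr0.
have nz_a : a != 0.
  apply/eqP => a0; move: Exa; rewrite a0 mulr0 => /esym/domA[] /eqP.
    by rewrite (negPf nz_y).
  by rewrite (negPf nz_b).
have [[y' yy']|inv_y] := invE y.
  by right; exists (a * y'); rewrite mulrA Exa mulrAC yy' mul1r.
have [[b' bb']|inv_b] := invE b.
  by left; exists (a * b'); rewrite mulrA Exa -mulrA bb' mulr1.
have [[a' aa']|inv_a] := invE a.
  have Dx : x = y * (b * a') by rewrite mulrA -Exa -mulrA aa' mulr1.
  have [//|[e be]] := irr_x _ _ Dx.
  by left; exists e; rewrite Dx -mulrA be mulr1.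
have [sa irr_sa Da] := factA a nz_a inv_a.
have [sy irr_sy Dy] := factA y nz_y inv_y.
have [sb irr_sb Db] := factA b nz_b inv_b.
have [|||s [pm sz ass]] := uniqA (x :: sa) (sy ++ sb).
- by move=> q; rewrite inE => /predU1P[->|/irr_sa].
- by move=> q; rewrite mem_cat => /orP[/irr_sy|/irr_sb].
- by rewrite big_cons big_cat /= -Da -Dy -Db.
have [u _ Dq] := ass 0%N (ltn0Sn _); rewrite /= in Dq.
have : s`_0 \in sy ++ sb by rewrite -(perm_mem pm) mem_nth // -sz.
have dvd (r : seq A) : s`_0 \in r -> exists k, \prod_(q <- r) q = x * k.
  move=> sr; exists (u * \prod_(q <- rem s`_0 r) q).
  by rewrite (perm_big _ (perm_to_rem sr)) big_cons mulrA Dq [x * u]mulrC.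
by rewrite mem_cat => /orP[/dvd|/dvd]; rewrite -?Dy -?Db; [left|right].
Qed.

Definition coord_class (R : realType) n (X : 'rV[R[i]]_n.+1 -> Prop)
    (hX : has_point X) : {mpoly R[i][n.+1]} -> homogeneous_coordinate_ring hX :=
  \pi_{ideal_quot (vanishing_ideal hX)}%qT.
HB.instance Definition _ (R : realType) n (X : 'rV[R[i]]_n.+1 -> Prop)
    (hX : has_point X) :=
  GRing.RMorphism.copy (coord_class hX)
    (\pi_{ideal_quot (vanishing_ideal hX)}%qT).

Lemma coord_class_eq0 (R : realType) n (X : 'rV[R[i]]_n.+1 -> Prop)
    (hX : has_point X) p : coord_class hX p = 0 <-> vanishes_on X p.
Proof.
rewrite -(rmorph0 (coord_class hX)).
split=> [/eqP|p0]; last apply/eqP.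
  by rewrite -Quotient.idealrBE subr0 => /asboolP.
by rewrite -Quotient.idealrBE subr0; apply/asboolP.
Qed.

Lemma coord_class_surj (R : realType) n (X : 'rV[R[i]]_n.+1 -> Prop)
    (hX : has_point X) a : exists p, a = coord_class hX p.
Proof. by exists (repr a); rewrite /coord_class reprK. Qed.

Lemma coord_class_neq0 (R : realType) n (X : 'rV[R[i]]_n.+1 -> Prop)
    (hX : has_point X) p v :
  v != 0 -> X v -> p.@[v 0] != 0 -> coord_class hX p != 0.
Proof.
by move=> nz_v Xv; apply: contra_neq => /coord_class_eq0/(_ v nz_v Xv).
Qed.

Lemma coord_class_noninvertible (R : realType) n d f
    (hX : has_point (@zero_set R n f)) (p : {mpoly R[i][n.+1]}) :
    hypersurface_equation d f -> p.@[fun=> 0] = 0 ->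
  ~ invertible (coord_class hX p).
Proof.
move=> [d_gt0 _ hf If] p0 [b]; have [q -> /eqP] := coord_class_surj b.
rewrite -rmorphM -subr_eq0 -(rmorph1 (coord_class hX)) -rmorphB => /eqP.
move=> /coord_class_eq0/If[h /(congr1 (meval (fun=> 0)))].
rewrite mevalB !mevalM p0 meval1 mul0r sub0r (dhomog_meval0 d_gt0 hf) //.
by rewrite mulr0 => /eqP; rewrite oppr_eq0 oner_eq0.
Qed.

(** A form of degree [d] goes to its class times ['X^d], so this morphism
    encodes the grading of the coordinate ring. Evaluation at 1 forgets the
    grading, evaluation at 0 keeps only the part of degree 0. *)
Definition grading (R : realType) n (X : 'rV[R[i]]_n.+1 -> Prop)
    (hX : has_point X) : {mpoly R[i][n.+1]} ->
    {poly homogeneous_coordinate_ring hX} :=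
  mmap (polyC \o coord_class hX \o @mpolyC n.+1 R[i])
       (fun i => (coord_class hX 'X_i)%:P * 'X).
HB.instance Definition _ (R : realType) n (X : 'rV[R[i]]_n.+1 -> Prop)
    (hX : has_point X) :=
  GRing.RMorphism.copy (grading hX)
    (mmap (polyC \o coord_class hX \o @mpolyC n.+1 R[i])
       (fun i => (coord_class hX 'X_i)%:P * 'X)).

Lemma gradingC (R : realType) n (X : 'rV[R[i]]_n.+1 -> Prop)
    (hX : has_point X) c : grading hX c%:MP = (coord_class hX c%:MP)%:P.
Proof. by rewrite /grading mmapC. Qed.

Lemma gradingX (R : realType) n (X : 'rV[R[i]]_n.+1 -> Prop)
    (hX : has_point X) i : grading hX 'X_i = (coord_class hX 'X_i)%:P * 'X.
Proof. by rewrite /grading mmapX mmap1U. Qed.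

Lemma grading_dhomog (R : realType) n (X : 'rV[R[i]]_n.+1 -> Prop)
    (hX : has_point X) d p :
  p \is d.-homog -> grading hX p = (coord_class hX p)%:P * 'X^d.
Proof.
move=> /dhomogP hp; rewrite [p]mpolyE !rmorph_sum mulr_suml.
rewrite !big_seq; apply: eq_bigr => m /hp <-; rewrite -mul_mpolyC.
rewrite !rmorphM /= gradingC -mulrA; congr (_ * _).
rewrite mpolyXE_id !rmorph_prod /= mdegE -prodrXr -big_split /=.
by apply: eq_bigr => i _; rewrite !rmorphXn /= gradingX exprMn.
Qed.

Lemma horner1_grading (R : realType) n (X : 'rV[R[i]]_n.+1 -> Prop)
    (hX : has_point X) p : (grading hX p).[1] = coord_class hX p.
Proof.
suff: (horner_eval 1 \o grading hX) =1 coord_class hX by move/(_ p).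
apply: mpoly_rmorph_ext => [c|i]; rewrite /= /horner_eval.
  by rewrite gradingC hornerC.
by rewrite gradingX !hornerE.
Qed.

Lemma horner0_grading (R : realType) n (X : 'rV[R[i]]_n.+1 -> Prop)
    (hX : has_point X) p :
  (grading hX p).[0] = coord_class hX (p.@[fun=> 0])%:MP.
Proof.
suff: (horner_eval 0 \o grading hX) =1
  (coord_class hX \o @mpolyC n.+1 R[i] \o meval (fun=> 0)) by move/(_ p).
apply: mpoly_rmorph_ext => [c|i]; rewrite /= /horner_eval.
  by rewrite gradingC hornerC mevalC.
by rewrite gradingX !hornerE mevalXU mpolyC0 rmorph0.
Qed.

Lemma mul_eq_linear_monomial (S : comNzRingType) (p q : {poly S}) c :
  is_domain S -> c != 0 -> p * q = c%:P * 'X -> size p = 1%N \/ size q = 1%N.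
Proof.
move=> domS nz_c Epq.
have nz_C : c%:P != 0 by rewrite polyC_eq0.
have nz_p : p != 0.
  apply: contra_eq_neq Epq => ->; rewrite mul0r eq_sym -size_poly_eq0.
  by rewrite size_mulX.
have nz_q : q != 0.
  apply: contra_eq_neq Epq => ->; rewrite mulr0 eq_sym -size_poly_eq0.
  by rewrite size_mulX.
have szpq : size (p * q) = (size p + size q).-1.
  apply: size_proper_mul; apply/eqP => /domS[] /eqP; rewrite lead_coef_eq0.
    exact/negP.
  exact/negP.
move: szpq nz_p nz_q; rewrite Epq size_mulX // size_polyC nz_c -!size_poly_gt0.
by lia.
Qed.

(** If ['X_i] is the class of [p * q], then [grading p * grading q] equals the
    class of ['X_i] times ['X], because [grading] kills the multiples of the
    form [f]. Over a domain one of the factors has degree 0, and then it is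
    the class of a nonzero constant. *)
Lemma coord_class_var_irreducible (R : realType) n d f
    (hX : has_point (@zero_set R n f)) i :
    hypersurface_equation d f -> is_domain (homogeneous_coordinate_ring hX) ->
    coord_class hX 'X_i != 0 ->
  irreducible_elt (coord_class hX 'X_i).
Proof.
move=> hypf domS nz_Xi; have [d_gt0 _ hf If] := hypf.
split=> // [|a b]; first by apply: (coord_class_noninvertible hypf); rewrite mevalXU.
have [p ->] := coord_class_surj a; have [q ->] := coord_class_surj b => Epq.
have nz_p : coord_class hX p != 0.
  by apply: contra_neq nz_Xi; rewrite Epq => ->; rewrite mul0r.
have nz_q : coord_class hX q != 0.
  by apply: contra_neq nz_Xi; rewrite Epq => ->; rewrite mulr0.
have Ephi : grading hX p * grading hX q = (coord_class hX 'X_i)%:P * 'X.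
  have /eqP := Epq; rewrite -rmorphM -subr_eq0 -rmorphB => /eqP.
  move=> /coord_class_eq0/If[h Dh].
  have f0 : coord_class hX f = 0 by apply/coord_class_eq0 => v _.
  rewrite -gradingX; apply/eqP; rewrite eq_sym -subr_eq0 -rmorphM -rmorphB Dh.
  by rewrite rmorphM /= (grading_dhomog _ hf) f0 mul0r mulr0.
(* A class r with grading of degree 0 equals its degree 0 part, the class of
   the constant r(0). *)
have const_inv r : size (grading hX r) = 1%N -> coord_class hX r != 0 ->
    invertible (coord_class hX r).
  move=> /eqP/size_poly1P[c _ Dr] nz_r.
  have Ec : coord_class hX r = coord_class hX (r.@[fun=> 0])%:MP.
    by rewrite -horner1_grading -horner0_grading Dr !hornerC.
  exists (coord_class hX (r.@[fun=> 0]^-1)%:MP).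
  rewrite Ec -rmorphM -mpolyCM divff ?mpolyC1 ?rmorph1 //.
  by apply: contra_neq nz_r => r0; rewrite Ec r0 mpolyC0 rmorph0.
have [szp|szq] := mul_eq_linear_monomial domS nz_Xi Ephi.
  by left; apply: const_inv.
by right; apply: const_inv.
Qed.

(** The points [v1] and [v2] witness that the class of ['X_i] divides neither
    the class of ['X_j] nor that of [G], and [v3] that it is not zero; this
    contradicts the primality of ['X_i] in the relation between the four
    classes given by [f = 0]. *)
Lemma linear_section_not_factorial (R : realType) n d i j
    (f F G : {mpoly R[i][n.+1]}) (v1 v2 v3 : 'rV[R[i]]_n.+1) :
    hypersurface_equation d f -> f = 'X_i * F + 'X_j * G ->
    [/\ zero_set f v1, v1 0 i = 0 & v1 0 j != 0] ->
    [/\ v2 != 0, zero_set f v2, v2 0 i = 0 & G.@[v2 0] != 0] ->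
    zero_set f v3 /\ v3 0 i != 0 ->
  ~ factorial_variety (zero_set f).
Proof.
move=> hypf Df [fv1 v1i v1j] [nz_v2 fv2 v2i Gv2] [fv3 v3i] [hX ufdS].
have nz_v (v : 'rV[R[i]]_n.+1) k : v 0 k != 0 -> v != 0.
  by apply: contra_neq => ->; rewrite mxE.
have irr_Xi : irreducible_elt (coord_class hX 'X_i).
  apply: (coord_class_var_irreducible hypf); first by case: ufdS.
  by apply: (coord_class_neq0 _ (nz_v _ _ v3i) fv3); rewrite mevalXU.
have rel : coord_class hX 'X_i * coord_class hX F
         = coord_class hX 'X_j * coord_class hX (- G).
  apply/eqP; rewrite rmorphN mulrN -addr_eq0 -!rmorphM -rmorphD -Df.
  by apply/eqP/coord_class_eq0 => v _.
have evalX h (p : {mpoly R[i][n.+1]}) (v : 'rV[R[i]]_n.+1) : coord_class hX p = coord_class hX 'X_i * h ->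
    v != 0 -> zero_set f v -> v 0 i = 0 -> p.@[v 0] = 0.
  have [q -> /eqP] := coord_class_surj h.
  rewrite -rmorphM -subr_eq0 -rmorphB => /eqP/coord_class_eq0 Ip nz fv vi.
  by have /eqP := Ip v nz fv; rewrite mevalB mevalM mevalXU vi mul0r subr0 => /eqP.
have [] := irreducible_prime ufdS irr_Xi rel => -[h Dh].
  have := evalX _ _ _ Dh (nz_v _ _ v1j) fv1 v1i.
  by rewrite mevalXU => /eqP; rewrite (negPf v1j).
have := evalX _ _ _ Dh nz_v2 fv2 v2i.
by rewrite mevalN => /eqP; rewrite oppr_eq0 (negPf Gv2).
Qed.

(** * Leading forms, derivatives and roots of unity *)

(** The form [H], possibly zero, is the part of degree [d] of [p], and [p] has
    no part of smaller degree. Allowing [H = 0] makes the notion stable under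
    sums and products. *)
Definition leading_form (n : nat) (A : nzRingType) d (p H : {mpoly A[n]}) :=
  H \is d.-homog /\ {in msupp (p - H), forall m, (d < mdeg m)%N}.

Lemma initial_formE (R : realType) n d (p H : {mpoly R[i][n]}) :
  leading_form d p H -> H != 0 -> initial_form p = H.
Proof.
move=> [/[dup] hH /dhomogP homH rest] nz_H.
have cE m : mdeg m = d -> p@_m = H@_m.
  move=> Dm; apply/eqP; rewrite -subr_eq0 -mcoeffB; apply: contraT.
  by rewrite -mcoeff_msupp => /rest; rewrite Dm ltnn.
have low m : m \in msupp p -> (d <= mdeg m)%N.
  rewrite -[p](subrK H) => /msuppD_le; rewrite mem_cat => /orP[/rest/ltnW //|].
  by move/homH=> /= ->.
have supH : mlead H \in msupp p.
  by rewrite mcoeff_msupp cE -?mcoeff_msupp ?mlead_supp // homH // mlead_supp.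
have nz_p : p != 0 by apply: contraTneq supH => ->; rewrite msupp0.
have Dd : mdeg (mlast p) = d.
  apply/eqP; rewrite eqn_leq low ?mlast_supp // andbT.
  rewrite -(homH _ (mlead_supp nz_H)) /=; apply: lemc_mdeg; exact: mlast_lemc.
rewrite /initial_form Dd -[p](subrK H) raddfD /= (pihomog_dE hH).
rewrite [X in X + _]pihomogE big_seq_cond big_pred0 ?add0r // => m.
by apply/negP => /andP[/rest lt_d /eqP Dm]; rewrite /= Dm ltnn in lt_d.
Qed.

Lemma leading_formD n (A : nzRingType) d (p q H K : {mpoly A[n]}) :
  leading_form d p H -> leading_form d q K -> leading_form d (p + q) (H + K).
Proof.
move=> [hH lp] [hK lq]; split; first exact: dhomogD.
move=> m; rewrite opprD addrACA => /msuppD_le; rewrite mem_cat.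
by move=> /orP[/lp|/lq].
Qed.

Lemma leading_formM n (A : nzRingType) d e (p q H K : {mpoly A[n]}) :
  leading_form d p H -> leading_form e q K -> leading_form (d + e) (p * q) (H * K).
Proof.
move=> [hH lp] [hK lq]; split; first exact: dhomogM.
have lowq m : m \in msupp q -> (e <= mdeg m)%N.
  rewrite -[q](subrK K) => /msuppD_le; rewrite mem_cat => /orP[/lq/ltnW //|].
  by move/dhomogP: hK => /[apply] /= ->.
have -> : p * q - H * K = (p - H) * q + H * (q - K).
  by rewrite mulrBl mulrBr addrA subrK.
move=> m /msuppD_le; rewrite mem_cat => /orP[] /msuppM_le/allpairsP[[m1 m2]] /=.
  by case=> /lp lt1 /lowq le2 ->; rewrite mdegD -addSn leq_add.
case=> m1H /lq lt2 ->; rewrite mdegD -addnS leq_add //.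
by move/dhomogP: hH => /(_ _ m1H) /= ->.
Qed.

Lemma leading_form1 n (A : nzRingType) : leading_form 0 (1 : {mpoly A[n]}) 1.
Proof. by split=> [|m]; rewrite ?dhomog1 // subrr msupp0. Qed.

Lemma leading_formX n (A : nzRingType) d k (p H : {mpoly A[n]}) :
  leading_form d p H -> leading_form (k * d) (p ^+ k) (H ^+ k).
Proof.
move=> lp; elim: k => [|k IHk]; first exact: leading_form1.
by rewrite !exprS mulSn; apply: leading_formM.
Qed.

Lemma leading_form_id n (A : nzRingType) d (p : {mpoly A[n]}) :
  p \is d.-homog -> leading_form d p p.
Proof. by move=> hp; split=> // m; rewrite subrr msupp0. Qed.

Lemma leading_form_higher n (A : nzRingType) d e (p H : {mpoly A[n]}) :
  (d < e)%N -> leading_form e p H -> leading_form d p 0.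
Proof.
move=> lt_de [/dhomogP hH lp]; split; first exact: dhomog0.
move=> m; rewrite subr0 -[p](subrK H) => /msuppD_le; rewrite mem_cat.
by move=> /orP[/lp/(ltn_trans lt_de) //|/hH /= ->].
Qed.

(** This is the first-order Taylor expansion of ['X^k] at [a]. *)
Lemma leading_form_expD n (A : comNzRingType) i (a : A) k :
  leading_form 1 (('X_i + a%:MP) ^+ k - (a ^+ k)%:MP : {mpoly A[n]})
    ((a ^+ k.-1 *+ k)%:MP * 'X_i).
Proof.
have hX : ('X_i : {mpoly A[n]}) \is 1.-homog by rewrite dhomogX /= mdeg1.
have hC c : (c%:MP : {mpoly A[n]}) \is 0.-homog.
  by rewrite -[c%:MP]mulr1 mul_mpolyC; apply/dhomogZ/dhomog1.
elim: k => [|k IHk].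
  rewrite mulr0n mpolyC0 mul0r !expr0 mpolyC1 subrr; split; first exact: dhomog0.
  by move=> m; rewrite subrr msupp0.
pose Q := ('X_i + a%:MP_[n]) ^+ k - (a ^+ k)%:MP.
have -> : ('X_i + a%:MP_[n]) ^+ k.+1 - (a ^+ k.+1)%:MP
    = Q * 'X_i + (a%:MP * Q + (a ^+ k)%:MP * 'X_i).
  by rewrite /Q !exprSr mpolyCM; ring.
have -> : (a ^+ k.+1.-1 *+ k.+1)%:MP * 'X_i
    = 0 + (a%:MP_[n] * ((a ^+ k.-1 *+ k)%:MP * 'X_i) + (a ^+ k)%:MP * 'X_i).
  rewrite add0r mulrA -mpolyCM -mulrDl -mpolyCD; congr (_%:MP * _).
  rewrite mulrSr; congr (_ + _); case: (k) => [|k']; first by rewrite mulr0n mulr0.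
  by rewrite mulrnAr -exprS.
apply: leading_formD; last apply: leading_formD.
- apply: leading_form_higher (leading_formM IHk (leading_form_id hX)) => //.
- exact: (leading_formM (leading_form_id (hC a)) IHk).
- exact: (leading_formM (leading_form_id (hC _)) (leading_form_id hX)).
Qed.

Lemma mderivXU n (A : nzRingType) (i j : 'I_n) :
  ('X_j : {mpoly A[n]})^`M(i) = (j == i)%:R.
Proof.
rewrite mderivX mnm1E; case: eqVneq => [->|_]; last by rewrite scale0r.
rewrite scale1r (_ : (U_(i) - U_(i))%MM = 0%MM) ?mpolyX0 //.
by apply/mnmP => k; rewrite !mnmE subnn.
Qed.

Lemma mderiv_exp n (A : comNzRingType) (i : 'I_n) (p : {mpoly A[n]}) k :
  (p ^+ k)^`M(i) = p^`M(i) * p ^+ k.-1 *+ k.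
Proof.
elim: k => [|k IHk]; first by rewrite expr0 -mpolyC1 mderivC mulr0n.
rewrite exprS mderivM IHk mulrSr addrC; congr (_ + _).
case: (k) => [|k']; first by rewrite !mulr0n mulr0.
by rewrite mulrnAr mulrCA -exprS.
Qed.

(** A common root would be a root [s] of [a + b s^k], since 0 is not a root of
    the derivative, and then the derivative takes the value [- k a] at [s]. *)
Lemma coprimep_binomial_deriv (F : numClosedFieldType) k (a b : F) :
  (0 < k)%N -> a != 0 ->
  coprimep ('X * (a%:P + b *: 'X^k)) ('X * (a%:P + b *: 'X^k))^`().
Proof.
move=> k_gt0 nz_a; set p := 'X * _; have Dp' : p^`() = a%:P + b *: 'X^k *+ k.+1.
  rewrite /p derivM derivX mul1r derivD derivC add0r derivZ derivXn.
  by rewrite -scalerAr mulrnAr -exprS prednK // -scalerMnr -addrA -mulrS.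
have nz_p' : p^`() != 0.
  apply/eqP => p'0; have := congr1 (horner^~ 0) p'0.
  rewrite Dp' !(hornerMn, hornerE) expr0n gtn_eqF // => /eqP.
  by rewrite mulr0 mul0rn addr0 (negPf nz_a).
rewrite /coprimep; apply: contraT => /closed_rootP[s]; rewrite root_gcd.
move=> /andP[/rootP ps /rootP p's]; move: ps p's; rewrite Dp' /p !(hornerMn, hornerE).
move=> /eqP; rewrite mulf_eq0 => /orP[/eqP->|/eqP Es].
  by rewrite expr0n gtn_eqF // mulr0 mul0rn addr0 => /eqP; rewrite (negPf nz_a).
have -> : b * s ^+ k = - a by apply/eqP; rewrite -addr_eq0 addrC Es.
rewrite mulrSr mulNrn addrCA subrr addr0 => /eqP; rewrite oppr_eq0.
by rewrite mulrn_eq0 (negPf nz_a) gtn_eqF.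
Qed.

Lemma primitive_root_exists (F : numClosedFieldType) n :
  (0 < n)%N -> exists z : F, n.-primitive_root z.
Proof.
move=> n_gt0; pose p : {poly F} := 'X^n - 1.
have [r Dp] := closed_field_poly_normal p.
rewrite (monicP _) ?monicXnsubC // scale1r in Dp.
have rn1 : all n.-unity_root r by apply/allP=> z; rewrite -root_prod_XsubC -Dp.
have sz_r : (n < (size r).+1)%N by rewrite -(size_prod_XsubC r id) -Dp size_XnsubC.
have [|z _ pz] := hasP (has_prim_root n_gt0 rn1 _ sz_r); last by exists z.
rewrite -separable_prod_XsubC -Dp; apply: separable_Xn_sub_1.
by rewrite pnatr_eq0 -lt0n.
Qed.

(** * The plane curves from which the equation is built *)

(** The term in [x ^+ t] is there to make the tangent cones at the points with
    [x = 0] and [y ^+ delta = w ^+ delta] smooth; it is completed by a power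
    of [w] to the degree [delta * t]. The last term excludes singularities at
    [w = 0]. *)
Definition branch (A : pzRingType) (t delta : nat) (w y x : A) : A :=
  (y ^+ delta - w ^+ delta) ^+ t + x ^+ t * w ^+ (delta.-1 * t) + x ^+ (delta * t).

Lemma rmorph_branch (A S : pzRingType) (phi : {rmorphism A -> S}) t delta w y x :
  phi (branch t delta w y x) = branch t delta (phi w) (phi y) (phi x).
Proof. by rewrite /branch !rmorphD rmorphM !rmorphXn rmorphB !rmorphXn. Qed.

(** The derivative of [x * branch t delta w y x] with respect to [x]. *)
Definition branch_dx (A : pzRingType) (t delta : nat) (w y x : A) : A :=
  (y ^+ delta - w ^+ delta) ^+ t + t.+1%:R * (x ^+ t * w ^+ (delta.-1 * t))
  + (delta * t).+1%:R * x ^+ (delta * t).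

(** The derivative of [x * branch t delta w y x] with respect to [y], divided
    by [delta * t]. *)
Definition branch_dy (A : pzRingType) (t delta : nat) (w y x : A) : A :=
  x * (y ^+ delta.-1 * (y ^+ delta - w ^+ delta) ^+ t.-1).

Lemma branch_scale (A : comPzRingType) t delta (s w y x : A) : (0 < delta)%N ->
  branch t delta (s * w) (s * y) (s * x) = s ^+ (delta * t) * branch t delta w y x.
Proof.
move=> d_gt0; rewrite /branch !exprMn -mulrBr exprMn -exprM.
have -> : s ^+ t * x ^+ t * (s ^+ (delta.-1 * t) * w ^+ (delta.-1 * t))
    = s ^+ (delta * t) * (x ^+ t * w ^+ (delta.-1 * t)).
  by rewrite mulrACA -exprD -mulSn prednK.
by rewrite -!mulrDr.
Qed.

Lemma branch_dx_scale (A : comPzRingType) t delta (s w y x : A) : (0 < delta)%N ->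
  branch_dx t delta (s * w) (s * y) (s * x) = s ^+ (delta * t) * branch_dx t delta w y x.
Proof.
move=> d_gt0; rewrite /branch_dx !exprMn -mulrBr exprMn -exprM.
have -> : s ^+ t * x ^+ t * (s ^+ (delta.-1 * t) * w ^+ (delta.-1 * t))
    = s ^+ (delta * t) * (x ^+ t * w ^+ (delta.-1 * t)).
  by rewrite mulrACA -exprD -mulSn prednK.
by rewrite !mulrDr ![s ^+ (delta * t) * (_%:R * _)]mulrCA.
Qed.

Lemma branch_dy_scale_eq0 (F : fieldType) t delta (s w y x : F) : s != 0 ->
  branch_dy t delta (s * w) (s * y) (s * x) = 0 -> branch_dy t delta w y x = 0.
Proof.
move=> nz_s; rewrite /branch_dy !exprMn -mulrBr exprMn => /eqP.
rewrite !mulf_eq0 !expf_eq0 (negPf nz_s) ?andbF /= => h; apply/eqP.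
by rewrite !mulf_eq0 !expf_eq0.
Qed.

Lemma branch_critical_at_infinity (F : numFieldType) t delta (y x : F) :
    (0 < t)%N -> (0 < delta)%N ->
    branch_dx t delta 0 y x = 0 -> branch_dy t delta 0 y x = 0 ->
  y = 0 /\ x = 0.
Proof.
move=> t_gt0 d_gt0 dx0 dy0.
have dt_gt0 : (0 < delta * t)%N by rewrite muln_gt0 d_gt0.
have expX0 m : (0 < m)%N -> (0 : F) ^+ m = 0 by move=> ?; rewrite expr0n gtn_eqF.
have [x0|nz_x] := eqVneq x 0.
  split=> //; move: dx0; rewrite /branch_dx x0 (expX0 _ d_gt0) (expX0 _ t_gt0) (expX0 _ dt_gt0).
  rewrite mul0r !mulr0 !addr0 subr0.
  by move/eqP; rewrite -exprM expf_eq0 dt_gt0 => /eqP.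
have y0 : y = 0.
  move/eqP: dy0; rewrite /branch_dy expX0 // subr0 !mulf_eq0 (negPf nz_x) /=.
  by rewrite !expf_eq0 => /orP[/andP[_ /eqP]|/andP[_ /andP[_ /eqP]]].
move: dx0; rewrite /branch_dx y0 (expX0 _ d_gt0) subrr (expX0 _ t_gt0) add0r.
have [->|d_neq1] := eqVneq delta 1%N.
  move/eqP; rewrite mul0n expr0 mulr1 mul1n -mulrDl -natrD mulf_eq0 pnatr_eq0.
  by rewrite expf_eq0 t_gt0 (negPf nz_x).
rewrite expX0 ?muln_gt0 ?t_gt0 ?andbT; last by lia.
move/eqP; rewrite !mulr0 add0r mulf_eq0 pnatr_eq0.
by rewrite expf_eq0 dt_gt0 (negPf nz_x).
Qed.

(** The derivative of [(y ^+ delta - 1) ^+ t] vanishes only where this power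
    is 0 or [y = 0]. *)
Lemma branch_critical_level (F : numFieldType) t delta (y x : F) :
    (0 < t)%N -> x != 0 -> branch_dy t delta 1 y x = 0 ->
  exists e : bool, (y ^+ delta - 1) ^+ t = e%:R * (-1) ^+ t.
Proof.
move=> t_gt0 nz_x /eqP; rewrite /branch_dy expr1n !mulf_eq0 (negPf nz_x) /=.
rewrite !expf_eq0 => /orP[/andP[d_gt1 /eqP->]|/andP[_ /eqP->]].
  by exists true; rewrite mul1r expr0n gtn_eqF ?sub0r //; lia.
by exists false; rewrite mul0r expr0n gtn_eqF.
Qed.

(** Put [a = (y ^+ delta - 1) ^+ t] and [X = x ^+ t]. If the value is 0 as
    well as the derivative, two linear relations between [a], [X] and [X ^+
    delta] hold, and they yield [delta * a = - (delta - 1) * X] and [1 + delta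
    * X ^+ (delta - 1) = 0]. The second excludes [delta = 1]. Then the first
    excludes [a = 0], and since [a] is otherwise a sign, it gives [1 <= `|X|];
    this contradicts the second. *)
Lemma branch_critical_value_neq0 (F : numFieldType) t delta (y x : F) :
    (0 < t)%N -> (0 < delta)%N -> x != 0 ->
    branch_dx t delta 1 y x = 0 -> branch_dy t delta 1 y x = 0 ->
  x * branch t delta 1 y x != 0.
Proof.
move=> t_gt0 d_gt0 nz_x dx0 dy0; have [e De] := branch_critical_level t_gt0 nz_x dy0.
rewrite mulf_eq0 (negPf nz_x) /=; apply/eqP => val0.
move: dx0 val0; rewrite /branch_dx /branch !expr1n De !mulr1 mulnC exprM.
set a := e%:R * _; set X := x ^+ t => dx0 val0.
have nz_X : X != 0 by rewrite expf_eq0 negb_and nz_x orbT.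
have nz_t : t%:R != 0 :> F by rewrite pnatr_eq0 -lt0n.
have D1 : delta.-1%:R = delta%:R - 1 :> F.
  by rewrite -[in RHS](prednK d_gt0) -natr1 addrK.
have Ea : delta%:R * a + delta.-1%:R * X = 0.
  apply: (mulfI nz_t); rewrite mulr0 D1.
  move: dx0; rewrite -!natr1 natrM => dx0.
  transitivity ((t%:R * delta%:R + 1) * (a + X + X ^+ delta)
     - (a + (t%:R + 1) * X + (t%:R * delta%:R + 1) * X ^+ delta)); first by ring.
  by rewrite val0 dx0 mulr0 subr0.
(* Eliminating a between the first relation and val0, and dividing by X. *)
have EX : 1 + delta%:R * X ^+ delta.-1 = 0.
  apply: (mulfI nz_X); rewrite mulr0 mulrDr mulr1 mulrCA -exprS prednK //.
  transitivity (delta%:R * (a + X + X ^+ delta) - (delta%:R * a + (delta%:R - 1) * X)).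
    by ring.
  by rewrite val0 -D1 Ea mulr0 subr0.
have d_gt1 : (1 < delta)%N.
  rewrite ltn_neqAle d_gt0 andbT; apply/eqP => d1.
  by move/eqP: EX; rewrite -d1 mul1r expr0 -(natrD _ 1 1) pnatr_eq0.
have nX_gt1 : 1 <= `|X|.
  case: e @a De Ea {dx0 val0} => a De Ea; last first.
    move/eqP: Ea; rewrite /a mul0r mulr0 add0r mulf_eq0 (negPf nz_X) orbF.
    by rewrite pnatr_eq0 => /eqP; lia.
  have /eqP := Ea; rewrite addr_eq0 => /eqP/(congr1 Num.norm).
  have na : `|a| = 1 by rewrite /a mul1r normrX normrN1 expr1n.
  rewrite normrN (normrM _ a) (normrM _ X) na !normr_nat mulr1 => Ed.
  have p_gt0 : 0 < delta.-1%:R :> F by rewrite ltr0n -ltnS prednK.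
  by rewrite -(ler_pM2l p_gt0) mulr1 -Ed ler_nat leq_pred.
have /eqP := EX; rewrite addrC addr_eq0 => /eqP/(congr1 Num.norm).
rewrite normrN normr1 normrM normr_nat normrX => EnX.
have : delta%:R <= 1 :> F.
  by rewrite -[X in _ <= X]EnX ler_peMr ?ler0n // exprn_ege1.
by rewrite lern1 leqNgt d_gt1.
Qed.

Lemma exists_notin (F : closedFieldType) (s : seq F) : exists c, c \notin s.
Proof.
have : \prod_(a <- s) ('X - a%:P) != 0 by exact/monic_neq0/monic_prod_XsubC.
by move=> /closed_nonrootP[c]; rewrite root_prod_XsubC; exists c.
Qed.

(** At a critical point with [x != 0], [branch_critical_level] leaves two
    possible values for [(y ^+ delta - 1) ^+ t]. For each of them [branch_dx]
    becomes a nonzero polynomial in [x] alone and the critical value a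
    function of [x], so there are finitely many values. *)
Lemma branch_critical_values (F : numClosedFieldType) t delta :
    (0 < t)%N -> (0 < delta)%N ->
  exists2 W : seq F, 0 \notin W &
    forall y x, branch_dx t delta 1 y x = 0 -> branch_dy t delta 1 y x = 0 ->
      (x = 0 /\ y ^+ delta = 1) \/ x * branch t delta 1 y x \in W.
Proof.
move=> t_gt0 d_gt0.
have dt_gt0 : (0 < delta * t)%N by rewrite muln_gt0 d_gt0.
pose lvl (e : bool) : F := e%:R * (-1) ^+ t.
pose P e := (lvl e)%:P + t.+1%:R *: 'X^t + (delta * t).+1%:R *: 'X^(delta * t).
have nz_P e : P e != 0.
  apply/eqP => /(congr1 (coefp (delta * t)))/eqP; rewrite /= coef0 !coefD !coefZ !coefXn coefC.
  rewrite gtn_eqF // eqxx mulr1 add0r -natrM -natrD pnatr_eq0.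
  by rewrite addnS.
have roots_P e : exists r : seq F, forall x, root (P e) x -> x \in r.
  have [r Dr] := closed_field_poly_normal (P e); exists r => x.
  by rewrite {1}Dr rootZ ?lead_coef_eq0 // root_prod_XsubC.
have [r0 Hr0] := roots_P false; have [r1 Hr1] := roots_P true.
pose val e x := x * (lvl e + x ^+ t + x ^+ (delta * t)).
pose W := [seq val false x | x <- r0] ++ [seq val true x | x <- r1].
exists [seq a <- W | a != 0]; first by rewrite mem_filter eqxx.
move=> y x dx0 dy0.
have [x0|nz_x] := eqVneq x 0.
  left; split=> //; move/eqP: dx0.
  rewrite /branch_dx x0 expr1n !expr0n !gtn_eqF // mul0r !mulr0 !addr0.
  by rewrite expf_eq0 t_gt0 subr_eq0 => /eqP.
right; rewrite mem_filter branch_critical_value_neq0 //=.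
have [e De] := branch_critical_level t_gt0 nz_x dy0.
have Dval : x * branch t delta 1 y x = val e x by rewrite /branch !expr1n De mulr1.
have Px : root (P e) x.
  apply/eqP; rewrite /P !hornerE -[RHS]dx0.
  by rewrite /branch_dx !expr1n mulr1 De.
rewrite Dval mem_cat; case: (e) Px => Px; apply/orP; [right|left].
  exact/map_f/Hr1.
exact/map_f/Hr0.
Qed.

(** The constant [c] avoids 0 and the quotients [- a / b] of critical values.
    For [w != 0] homogeneity reduces to [w = 1], where a singular point gives
    two critical values [a] and [b] with [a + c * b = 0]. *)
Lemma weighted_sum_no_singularity (F : numClosedFieldType) t delta :
    (0 < t)%N -> (0 < delta)%N ->
  exists2 c : F, c != 0 &
    forall w y z v u : F,
      branch_dx t delta w y u = 0 -> branch_dy t delta w y u = 0 ->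
      branch_dx t delta w z v = 0 -> branch_dy t delta w z v = 0 ->
      u * branch t delta w y u + v * (c * branch t delta w z v) = 0 ->
      [/\ w = 0, y = 0, z = 0, v = 0 & u = 0] \/
      [/\ w != 0, v = 0, u = 0, y ^+ delta = w ^+ delta
         & z ^+ delta = w ^+ delta].
Proof.
move=> t_gt0 d_gt0; have [W nzW critW] := branch_critical_values F t_gt0 d_gt0.
have [c] := exists_notin (0 :: [seq - a / b | a <- W, b <- W]).
rewrite inE negb_or => /andP[nz_c cW]; exists c => // w y z v u.
have [->|nz_w] := eqVneq w 0.
  move=> dxu dyu dxv dyv _; left.
  have [-> ->] := branch_critical_at_infinity t_gt0 d_gt0 dxu dyu.
  by have [-> ->] := branch_critical_at_infinity t_gt0 d_gt0 dxv dyv.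
(* Dehomogenization: x * branch has degree delta * t + 1. *)
have affine p x : branch_dx t delta w p x = 0 -> branch_dy t delta w p x = 0 ->
    (x = 0 /\ p ^+ delta = w ^+ delta) \/
    (exists2 a, a \in W & x * branch t delta w p x = w ^+ (delta * t).+1 * a).
  have nz_wn m : w ^+ m != 0 by rewrite expf_eq0 negb_and nz_w orbT.
  have Dw : w = w * 1 by rewrite mulr1.
  have Dp : p = w * (p / w) by rewrite mulrC divfK.
  have Dx : x = w * (x / w) by rewrite mulrC divfK.
  rewrite {1}Dw {1}Dp {1}Dx branch_dx_scale // => /eqP.
  rewrite mulf_eq0 (negPf (nz_wn _)) /= => /eqP dx0.
  rewrite {1}Dw {1}Dp {1}Dx => /(branch_dy_scale_eq0 nz_w) dy0.
  have [[x0 pd]|aW] := critW _ _ dx0 dy0.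
    by left; rewrite Dx x0 mulr0 Dp exprMn pd mulr1.
  right; exists (x / w * branch t delta 1 (p / w) (x / w)) => //.
  rewrite [in LHS]Dw [in LHS]Dp [in LHS]Dx branch_scale //.
  by rewrite mulrACA -exprS.
move=> dxu dyu dxv dyv; rewrite mulrCA => f0; right.
have [[u0 yd]|[a aW Da]] := affine _ _ dxu dyu.
  have [[v0 zd]|[b bW Db]] := affine _ _ dxv dyv; first by split.
  move/eqP: f0; rewrite u0 mul0r add0r Db !mulf_eq0 (negPf nz_c) expf_eq0.
  by rewrite (negPf nz_w) andbF => /eqP b0; rewrite -b0 bW in nzW.
have [[v0 zd]|[b bW Db]] := affine _ _ dxv dyv.
  move/eqP: f0; rewrite v0 mul0r mulr0 addr0 Da mulf_eq0 expf_eq0.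
  by rewrite (negPf nz_w) andbF => /eqP a0; rewrite -a0 aW in nzW.
have nz_b : b != 0 by apply: contraNneq nzW => <-.
case/negP: cW; apply/allpairsP; exists (a, b); split=> //=.
apply/(canRL (mulfK nz_b))/eqP; rewrite -addr_eq0 addrC.
move/eqP: f0; rewrite Da Db mulrCA -mulrDr mulf_eq0 expf_eq0.
by rewrite (negPf nz_w) andbF.
Qed.

(** * The threefold: equation, fibre and homogeneity *)

Local Notation co k := (@Ordinal 5 k isT).
Local Notation lo k := (@Ordinal 4 k isT).

Definition equation (A : pzRingType) (t delta : nat) (c w y z v u : A) : A :=
  u * branch t delta w y u + v * (c * branch t delta w z v).

Lemma rmorph_equation (A S : pzRingType) (phi : {rmorphism A -> S}) t delta c w y z v u :
  phi (equation t delta c w y z v u)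
  = equation t delta (phi c) (phi w) (phi y) (phi z) (phi v) (phi u).
Proof. by rewrite /equation rmorphD !rmorphM !rmorph_branch. Qed.

Definition threefold (F : comNzRingType) (t delta : nat) (c : F) : {mpoly F[5]} :=
  equation t delta c%:MP 'X_(co 0) 'X_(co 1) 'X_(co 2) 'X_(co 3) 'X_(co 4).

Lemma meval_threefold (F : comNzRingType) t delta (c : F) x :
  (threefold t delta c).@[x]
  = equation t delta c (x (co 0)) (x (co 1)) (x (co 2)) (x (co 3)) (x (co 4)).
Proof. by rewrite /threefold (rmorph_equation (meval x)) /= !mevalXU mevalC. Qed.

Lemma fibreX_last n (F : comNzRingType) (x : 'I_n -> F) i :
  nat_of_ord i = n -> fibre x 'X_i = 'X.
Proof.
move=> Di; rewrite (_ : i = ord_max); last exact/val_inj.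
by rewrite fibreX unlift_none.
Qed.

Lemma fibreX_lt n (F : comNzRingType) (x : 'I_n -> F) i (j : 'I_n) :
  nat_of_ord i = j -> fibre x 'X_i = (x j)%:P.
Proof.
move=> Di; have -> : i = lift ord_max j.
  by apply/val_inj; rewrite /= /bump leqNgt ltn_ord.
by rewrite fibreX liftK.
Qed.

Lemma fibre_threefold (F : comNzRingType) t delta (c : F) (x : 'I_4 -> F) :
  fibre x (threefold t delta c)
  = equation t delta c%:P (x (lo 0))%:P (x (lo 1))%:P (x (lo 2))%:P (x (lo 3))%:P 'X.
Proof.
by rewrite /threefold (rmorph_equation (fibre x)) /= fibreC (fibreX_last _ (i := co 4)) //
  (fibreX_lt _ (j := lo 0)) // (fibreX_lt _ (j := lo 1)) //
  (fibreX_lt _ (j := lo 2)) // (fibreX_lt _ (j := lo 3)).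
Qed.

Lemma dhomogXn n (A : nzRingType) (i : 'I_n) k : ('X_i ^+ k : {mpoly A[n]}) \is k.-homog.
Proof.
have hX : ('X_i : {mpoly A[n]}) \is 1.-homog by rewrite dhomogX /= mdeg1.
by have := dhomogMn k hX; rewrite mul1n.
Qed.

Lemma dhomogCM n (A : nzRingType) (c : A) d (p : {mpoly A[n]}) :
  p \is d.-homog -> c%:MP * p \is d.-homog.
Proof. by rewrite mul_mpolyC; exact: dhomogZ. Qed.

Lemma branch_dhomog n (A : nzRingType) t delta (i j k : 'I_n) : (0 < delta)%N ->
  branch t delta ('X_i : {mpoly A[n]}) 'X_j 'X_k \is (delta * t).-homog.
Proof.
move=> d_gt0; rewrite /branch; apply: dhomogD; last exact: dhomogXn.
apply: dhomogD; first by apply/dhomogMn/rpredB; exact: dhomogXn.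
have -> : (delta * t = t + delta.-1 * t)%N by rewrite -mulSn prednK.
by apply: dhomogM; exact: dhomogXn.
Qed.

Lemma threefold_dhomog (F : comNzRingType) t delta (c : F) : (0 < delta)%N ->
  threefold t delta c \is (delta * t + 1).-homog.
Proof.
move=> d_gt0; rewrite addn1; apply: dhomogD; rewrite -(add1n (delta * t)); apply: dhomogM.
- exact: (dhomogXn _ _ 1).
- exact: branch_dhomog.
- exact: (dhomogXn _ _ 1).
- exact/dhomogCM/branch_dhomog.
Qed.

(** Over the point (0, 1, 0, 0) only the first summand of the equation
    survives; for [delta = 1] its two powers of ['X] coincide, hence the two
    possible shapes. *)
Lemma fibre_threefold_binomial (F : numClosedFieldType) t delta (c : F) :
    (0 < t)%N -> (0 < delta)%N ->
  exists k (b : F), (0 < k)%N /\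
    fibre (fun i => (i == lo 1)%:R) (threefold t delta c)
    = 'X * (1%:P + b *: 'X^k).
Proof.
move=> t_gt0 d_gt0; have dt_gt0 : (0 < delta * t)%N by rewrite muln_gt0 d_gt0.
rewrite fibre_threefold /equation /= !polyC0 mul0r addr0 /branch.
rewrite expr1n [0 ^+ delta]expr0n gtn_eqF // subr0 polyC1 expr1n -addrA.
have [->|d_neq1] := eqVneq delta 1%N.
  exists t, 2; split=> //; rewrite mul0n mul1n expr0 mulr1.
  by rewrite scaler_nat mulr2n.
exists (delta * t)%N, 1; split=> //; rewrite expr0n gtn_eqF ?mulr0 ?add0r ?scale1r //.
by rewrite muln_gt0 t_gt0 andbT; lia.
Qed.

Lemma threefold_hypersurface (R : realType) t delta (c : R[i]) :
    (0 < t)%N -> (0 < delta)%N ->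
  hypersurface_equation (delta * t + 1) (threefold t delta c).
Proof.
move=> t_gt0 d_gt0.
have [k [b [k_gt0 Dp]]] := fibre_threefold_binomial c t_gt0 d_gt0.
apply: (separable_fibre_hypersurface (x0 := fun i => (i == lo 1)%:R)).
- by rewrite addn1.
- exact: threefold_dhomog.
- rewrite meval_threefold /insert_last.
  have -> : unlift ord_max (co 4) = None by rewrite (_ : co 4 = ord_max) ?unlift_none //; exact/val_inj.
  have other (i : 'I_5) : (i < 4)%N -> (if unlift ord_max i is Some _ then 0 else 1) = 0 :> R[i].
    by case: unliftP => // ->; rewrite ltnn.
  rewrite !other // /equation mul1r mul0r addr0 /branch !expr1n subrr mul1r.
  rewrite !expr0n gtn_eqF // add0r -(natrD _ _ 1) pnatr_eq0.
  by rewrite addn1.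
- by rewrite Dp; apply: coprimep_binomial_deriv => //; rewrite oner_eq0.
Qed.

Lemma mderiv_mul_branch n (A : comNzRingType) (i : 'I_n) t delta (w y x : {mpoly A[n]}) :
    (0 < t)%N -> (0 < delta)%N -> w^`M(i) = 0 ->
  (x * branch t delta w y x)^`M(i)
  = x^`M(i) * branch_dx t delta w y x + y^`M(i) * branch_dy t delta w y x *+ (delta * t).
Proof.
move=> t_gt0 d_gt0 w'0; have dt_gt0 : (0 < delta * t)%N by rewrite muln_gt0 d_gt0.
rewrite mderivM /branch !mderivD mderivM !mderiv_exp mderivB !mderiv_exp w'0.
rewrite !mul0r !mul0rn subr0 mulr0 addr0 /branch_dx /branch_dy.
set N := w ^+ (_ * t); set B := y ^+ delta - _.
have -> : x ^+ t = x * x ^+ t.-1 by rewrite -exprS prednK.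
have -> : x ^+ (delta * t) = x * x ^+ (delta * t).-1 by rewrite -exprS prednK.
ring.
Qed.

(** * Nodes, singular locus and failure of factoriality *)

Lemma rmorph_branch_dx (A S : pzRingType) (phi : {rmorphism A -> S}) t delta w y x :
  phi (branch_dx t delta w y x) = branch_dx t delta (phi w) (phi y) (phi x).
Proof.
by rewrite /branch_dx !rmorphD !rmorphM !rmorph_nat !rmorphXn rmorphB !rmorphXn.
Qed.

Lemma rmorph_branch_dy (A S : pzRingType) (phi : {rmorphism A -> S}) t delta w y x :
  phi (branch_dy t delta w y x) = branch_dy t delta (phi w) (phi y) (phi x).
Proof. by rewrite /branch_dy !rmorphM !rmorphXn rmorphB !rmorphXn. Qed.

Lemma meval_mderiv_mul_branch n (F : comNzRingType) t delta i j k l (x : 'I_n -> F) :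
    (0 < t)%N -> (0 < delta)%N -> l != i ->
  ('X_k * branch t delta 'X_l 'X_j 'X_k)^`M(i).@[x]
  = (k == i)%:R * branch_dx t delta (x l) (x j) (x k)
    + (j == i)%:R * branch_dy t delta (x l) (x j) (x k) *+ (delta * t).
Proof.
move=> t_gt0 d_gt0 ne_li.
have w'0 : ('X_l : {mpoly F[n]})^`M(i) = 0 by rewrite mderivXU (negPf ne_li).
have dX m : ('X_m : {mpoly F[n]})^`M(i).@[x] = (m == i)%:R.
  by rewrite mderivXU (rmorph_nat (meval x)).
rewrite (mderiv_mul_branch _ _ t_gt0 d_gt0 w'0) mevalD mevalMn mevalM dX.
rewrite (rmorph_branch_dx (meval x)) [meval x (_ * _)]mevalM dX.
by rewrite (rmorph_branch_dy (meval x)) /= !mevalXU.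
Qed.

Lemma meval_mderiv_threefold (F : comNzRingType) t delta (c : F) i (x : 'I_5 -> F) :
    (0 < t)%N -> (0 < delta)%N -> i != co 0 ->
  (threefold t delta c)^`M(i).@[x]
  = ((co 4 == i)%:R * branch_dx t delta (x (co 0)) (x (co 1)) (x (co 4))
     + (co 1 == i)%:R * branch_dy t delta (x (co 0)) (x (co 1)) (x (co 4)) *+ (delta * t))
  + c * ((co 3 == i)%:R * branch_dx t delta (x (co 0)) (x (co 2)) (x (co 3))
     + (co 2 == i)%:R * branch_dy t delta (x (co 0)) (x (co 2)) (x (co 3)) *+ (delta * t)).
Proof.
move=> t_gt0 d_gt0; rewrite eq_sym => i_neq0.
rewrite /threefold /equation [_ * (_%:MP * _)]mulrCA mderivD mderiv_mulC.
rewrite mevalD.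
rewrite (mevalM x c%:MP) mevalC.
by congr (_ + _ * _); apply: meval_mderiv_mul_branch.
Qed.

Lemma threefold_partials (F : numFieldType) t delta (c : F) (x : 'I_5 -> F) :
    (0 < t)%N -> (0 < delta)%N -> c != 0 ->
    (forall i, (threefold t delta c)^`M(i).@[x] = 0) ->
  [/\ branch_dx t delta (x (co 0)) (x (co 1)) (x (co 4)) = 0,
      branch_dy t delta (x (co 0)) (x (co 1)) (x (co 4)) = 0,
      branch_dx t delta (x (co 0)) (x (co 2)) (x (co 3)) = 0
    & branch_dy t delta (x (co 0)) (x (co 2)) (x (co 3)) = 0].
Proof.
move=> t_gt0 d_gt0 nz_c df.
have nz_dt : (delta * t == 0)%N = false by rewrite muln_eq0 !gtn_eqF.
have E i (i_neq0 : i != co 0) :=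
  etrans (esym (meval_mderiv_threefold c x t_gt0 d_gt0 i_neq0)) (df i).
have := E (co 4) isT; have := E (co 1) isT; have := E (co 3) isT; have := E (co 2) isT.
rewrite /= !(mul0r, mul1r, mul0rn, add0r, addr0, mulr0).
move=> /eqP; rewrite mulf_eq0 (negPf nz_c) mulrn_eq0 nz_dt => /eqP dyv.
move=> /eqP; rewrite mulf_eq0 (negPf nz_c) => /eqP dxv.
by move=> /eqP; rewrite mulrn_eq0 nz_dt => /eqP dyu ->.
Qed.

Definition row5 (A : nmodType) (w y z v u : A) : 'rV[A]_5 :=
  \row_j nth 0 [:: w; y; z; v; u] j.

Lemma row5E (A : nmodType) (x : 'rV[A]_5) :
  x = row5 (x 0 (co 0)) (x 0 (co 1)) (x 0 (co 2)) (x 0 (co 3)) (x 0 (co 4)).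
Proof.
apply/rowP => j; rewrite mxE; case: j => -[|[|[|[|[|//]]]]] ? /=;
  by congr (x 0 _); apply/val_inj.
Qed.

Definition node (F : pzRingType) (delta : nat) (z : F) (a : nat) : 'rV[F]_5 :=
  row5 1 (z ^+ (a %/ delta)) (z ^+ (a %% delta)) 0 0.

Lemma node_inj (R : realType) delta (z : R[i]) (a b : 'I_(delta ^ 2)) :
    delta.-primitive_root z -> same_point (node delta z a) (node delta z b) ->
  a = b.
Proof.
move=> prim_z [s _ Dv]; have d_gt0 := prim_order_gt0 prim_z.
have E j := congr1 (fun v : 'rV_5 => v 0 j) Dv.
have := E (co 0); have := E (co 1); have := E (co 2); rewrite !mxE /=.
move=> E2 E1 s1; move: E1 E2; rewrite -{}[s]mulr1 -s1 !mul1r.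
have ltq (m : 'I_(delta ^ 2)) : (m %/ delta < delta)%N.
  by rewrite ltn_divLR // mulnn.
move=> /eqP; rewrite (eq_prim_root_expr prim_z) (modn_small (ltq a)) (modn_small (ltq b)) => /eqP Eq.
move=> /eqP; rewrite (eq_prim_root_expr prim_z) !modn_mod => /eqP Er.
by apply/val_inj; rewrite /= (divn_eq a delta) (divn_eq b delta) Eq Er.
Qed.

Lemma node_exists (R : realType) delta (z w y p : R[i]) :
    delta.-primitive_root z -> w != 0 -> y ^+ delta = w ^+ delta ->
    p ^+ delta = w ^+ delta ->
  exists a : 'I_(delta ^ 2), same_point (node delta z a) (row5 w y p 0 0).
Proof.
move=> prim_z nz_w yd pd; have d_gt0 := prim_order_gt0 prim_z.
have root q : q ^+ delta = w ^+ delta -> exists2 i : 'I_delta, True & q = w * z ^+ i.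
  move=> qd; have := prim_rootP prim_z (x := q / w).
  rewrite exprMn qd exprVn divff ?expf_eq0 ?negb_and ?nz_w ?orbT // => /(_ erefl)[i Di].
  by exists i; rewrite // -Di mulrC divfK.
have [i _ ->] := root _ yd; have [j _ ->] := root _ pd.
have lt_a : (i * delta + j < delta ^ 2)%N.
  have := ltn_ord i; have := ltn_ord j; rewrite expnS expn1 => ltj lti.
  by rewrite (leq_trans (n := i.+1 * delta)) ?leq_mul2r ?lti ?orbT // mulSn addnC ltn_add2r.
exists (Ordinal lt_a), w => //; rewrite /node /= divnMDl // divn_small // addn0.
rewrite modnMDl modn_small //; apply/rowP => k; rewrite !mxE.
by case: k => -[|[|[|[|[|//]]]]] ? /=; rewrite ?mulr1 ?mulr0.
Qed.

Lemma meval_row5 (F : comNzRingType) t delta (c w y z v u : F) :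
  (threefold t delta c).@[row5 w y z v u 0] = equation t delta c w y z v u.
Proof. by rewrite meval_threefold !mxE. Qed.

Lemma branch_root (A : pzRingType) t delta (w y : A) : (0 < t)%N -> (0 < delta)%N ->
  y ^+ delta = w ^+ delta -> branch t delta w y 0 = 0.
Proof.
move=> t_gt0 d_gt0 yd; rewrite /branch yd subrr.
by rewrite !expr0n muln_eq0 !gtn_eqF // mul0r !addr0.
Qed.

(** At a point where all four factors vanish, [p * q + r * s] lies in the
    square of the maximal ideal. *)
Lemma meval_mderiv_mul2 n (A : comNzRingType) i (p q r s : {mpoly A[n]}) x :
    p.@[x] = 0 -> q.@[x] = 0 -> r.@[x] = 0 -> s.@[x] = 0 ->
  (p * q + r * s)^`M(i).@[x] = 0.
Proof.
move=> p0 q0 r0 s0; rewrite mderivD !mderivM !mevalD !mevalM p0 q0 r0 s0.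
by rewrite !(mul0r, mulr0) !addr0.
Qed.

Lemma singular_node (R : realType) t delta (c z : R[i]) a v :
    (0 < t)%N -> delta.-primitive_root z ->
    same_point (node delta z a) v -> v != 0 ->
  singular_point (threefold t delta c) v.
Proof.
move=> t_gt0 prim_z [s nz_s ->] nz_v; have d_gt0 := prim_order_gt0 prim_z.
have zd k : (s * z ^+ k) ^+ delta = (s * 1) ^+ delta.
  by rewrite !exprMn exprAC (prim_expr_order prim_z) !expr1n.
split=> // [|i].
  by rewrite /zero_set meval_threefold !mxE /= !mulr0 /equation !mul0r addr0.
apply: meval_mderiv_mul2; rewrite ?mevalXU ?mevalM ?(rmorph_branch (meval _)) /= ?mevalXU !mxE /= ?mulr0 //.
  exact: branch_root.
by rewrite branch_root // mulr0.
Qed.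

Lemma singular_threefold (R : realType) t delta (c z : R[i]) v :
    (0 < t)%N -> delta.-primitive_root z -> c != 0 ->
    (forall w y z v u : R[i],
      branch_dx t delta w y u = 0 -> branch_dy t delta w y u = 0 ->
      branch_dx t delta w z v = 0 -> branch_dy t delta w z v = 0 ->
      u * branch t delta w y u + v * (c * branch t delta w z v) = 0 ->
      [/\ w = 0, y = 0, z = 0, v = 0 & u = 0] \/
      [/\ w != 0, v = 0, u = 0, y ^+ delta = w ^+ delta
         & z ^+ delta = w ^+ delta]) ->
    v != 0 ->
  singular_point (threefold t delta c) v <->
  exists a : 'I_(delta ^ 2), same_point (node delta z a) v.
Proof.
move=> t_gt0 prim_z nz_c generic nz_v; have d_gt0 := prim_order_gt0 prim_z.
split=> [[_ fv df]|[a av]]; last exact: (singular_node c t_gt0 prim_z av).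
have [dxu dyu dxv dyv] := threefold_partials t_gt0 d_gt0 nz_c df.
move: fv; rewrite /zero_set meval_threefold /equation => fv.
rewrite [v]row5E; have [[w0 y0 p0 v0 u0]|[nz_w v0 u0 yd pd]] := generic _ _ _ _ _ dxu dyu dxv dyv fv.
  case/eqP: nz_v; rewrite [v]row5E w0 y0 p0 v0 u0; apply/rowP => j; rewrite !mxE.
  by case: j => -[|[|[|[|[|//]]]]].
by rewrite v0 u0; apply: node_exists.
Qed.

Lemma threefold_not_factorial (R : realType) t delta (c : R[i]) :
    (0 < t)%N -> (0 < delta)%N -> c != 0 ->
  ~ factorial_variety (zero_set (threefold t delta c)).
Proof.
move=> t_gt0 d_gt0 nz_c.
have dt_gt0 : (0 < delta * t)%N by rewrite muln_gt0 d_gt0.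
(* The surface u = B(w,z,v) = 0 meets w = 0 outside the plane u = v = 0. *)
have [r br0] : exists r : R[i], branch t delta 0 r 1 = 0.
  exists ((delta * t).-root (- (1 * 0 ^+ (delta.-1 * t) + 1))).
  rewrite /branch !expr1n [0 ^+ delta]expr0n gtn_eqF // subr0 -exprM rootCK //.
  by rewrite -addrA addNr.
have b010 : branch t delta 0 1 0 = 1 :> R[i].
  rewrite /branch expr1n (expr0n _ delta) gtn_eqF // subr0 expr1n (expr0n _ t).
  by rewrite gtn_eqF // mul0r (expr0n _ (delta * t)) gtn_eqF // !addr0.
have hypf := threefold_hypersurface c t_gt0 d_gt0.
apply: (linear_section_not_factorial (v1 := row5 0 0 r 1 0)
  (v2 := row5 0 0 1 0 0) (v3 := row5 0 r 0 0 1) hypf (erefl _)).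
- rewrite /zero_set meval_row5 !mxE /equation /=; split=> //; last exact: oner_neq0.
  by rewrite mul0r add0r br0 !mulr0.
- split.
  + apply/eqP => /(congr1 (fun v : 'rV_5 => v 0 (co 2))); rewrite !mxE /= => /eqP.
    by rewrite oner_eq0.
  + by rewrite /zero_set meval_row5 /equation !mul0r addr0.
  + by rewrite mxE.
  + rewrite mevalM mevalC (rmorph_branch (meval _)) /= !mevalXU !mxE /= b010 mulr1.
    exact: nz_c.
- split; last by rewrite mxE /= oner_eq0.
  by rewrite /zero_set meval_row5 /equation br0 mul0r mulr0 addr0.
Qed.

(** * Tangent cones at the nodes *)

(** The leading form of [branch] at a point where [x = 0], [w = 1] and [y ^+
    delta = 1]. *)
Definition cone_branch (A : pzRingType) (t : nat) (k kappa y x : A) : A :=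
  (k * y) ^+ t + kappa * x ^+ t.

Lemma rmorph_cone_branch (A S : pzRingType) (phi : {rmorphism A -> S}) t k kappa y x :
  phi (cone_branch t k kappa y x) = cone_branch t (phi k) (phi kappa) (phi y) (phi x).
Proof. by rewrite /cone_branch rmorphD rmorphM !rmorphXn rmorphM. Qed.

Definition cone_equation (A : pzRingType) (t : nat) (c k l kappa y z v u : A) : A :=
  u * cone_branch t k kappa y u + v * (c * cone_branch t l kappa z v).

Lemma rmorph_cone_equation (A S : pzRingType) (phi : {rmorphism A -> S})
    t c k l kappa y z v u :
  phi (cone_equation t c k l kappa y z v u)
  = cone_equation t (phi c) (phi k) (phi l) (phi kappa) (phi y) (phi z) (phi v) (phi u).
Proof. by rewrite /cone_equation rmorphD !rmorphM !rmorph_cone_branch. Qed.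

Definition node_cone (F : comNzRingType) (t : nat) (c k l kappa : F) : {mpoly F[4]} :=
  cone_equation t c%:MP k%:MP l%:MP kappa%:MP 'X_(lo 0) 'X_(lo 1) 'X_(lo 2) 'X_(lo 3).

Lemma meval_node_cone (F : comNzRingType) t (c k l kappa : F) x :
  (node_cone t c k l kappa).@[x]
  = cone_equation t c k l kappa (x (lo 0)) (x (lo 1)) (x (lo 2)) (x (lo 3)).
Proof. by rewrite /node_cone (rmorph_cone_equation (meval x)) /= !mevalXU !mevalC. Qed.

Lemma fibre_node_cone (F : comNzRingType) t (c k l kappa : F) (x : 'I_3 -> F) :
  fibre x (node_cone t c k l kappa)
  = cone_equation t c%:P k%:P l%:P kappa%:P (x (@Ordinal 3 0 isT))%:P
      (x (@Ordinal 3 1 isT))%:P (x (@Ordinal 3 2 isT))%:P 'X.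
Proof.
by rewrite /node_cone (rmorph_cone_equation (fibre x)) /= !fibreC
  (fibreX_last _ (i := lo 3)) // (fibreX_lt _ (j := @Ordinal 3 0 isT)) //
  (fibreX_lt _ (j := @Ordinal 3 1 isT)) // (fibreX_lt _ (j := @Ordinal 3 2 isT)).
Qed.

Lemma cone_branch_dhomog n (A : nzRingType) t (k kappa : A) (i j : 'I_n) :
  cone_branch t (k%:MP : {mpoly A[n]}) kappa%:MP 'X_i 'X_j \is t.-homog.
Proof.
apply: dhomogD; last exact/dhomogCM/dhomogXn.
by have := dhomogMn t (dhomogCM k (dhomogXn A i 1)); rewrite mul1n.
Qed.

Lemma node_cone_dhomog (F : comNzRingType) t (c k l kappa : F) :
  node_cone t c k l kappa \is (t + 1).-homog.
Proof.
rewrite addnC; apply: dhomogD; apply: dhomogM.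
- exact: (dhomogXn _ _ 1).
- exact: cone_branch_dhomog.
- exact: (dhomogXn _ _ 1).
- exact/dhomogCM/cone_branch_dhomog.
Qed.

Lemma mderiv_mul_cone_branch n (A : comNzRingType) (i : 'I_n) t (k kappa : A)
    (y x : {mpoly A[n]}) : (0 < t)%N ->
  (x * cone_branch t k%:MP kappa%:MP y x)^`M(i)
  = x^`M(i) * ((k%:MP * y) ^+ t + (kappa *+ t.+1)%:MP * x ^+ t)
    + y^`M(i) * (k%:MP * (x * (k%:MP * y) ^+ t.-1)) *+ t.
Proof.
move=> t_gt0; rewrite mderivM /cone_branch mderivD mderiv_exp !mderiv_mulC mderiv_exp.
have -> : x ^+ t = x * x ^+ t.-1 by rewrite -exprS prednK.
rewrite mpolyCMn; ring.
Qed.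

(** The hypotheses are the vanishing of the two partial derivatives of [x *
    cone_branch t k kappa y x], up to nonzero constants. *)
Lemma cone_branch_smooth (F : numFieldType) t (k kappa y x : F) :
    (0 < t)%N -> k != 0 -> kappa != 0 ->
    (k * y) ^+ t + kappa *+ t.+1 * x ^+ t = 0 -> x * (k * y) ^+ t.-1 = 0 ->
  y = 0 /\ x = 0.
Proof.
move=> t_gt0 nz_k nz_kappa dx /eqP dy.
have nz_tk : kappa *+ t.+1 != 0 by rewrite mulrn_eq0.
have [x0|nz_x] := eqVneq x 0.
  split=> //; move/eqP: dx; rewrite x0 (expr0n _ t) gtn_eqF // mulr0 addr0.
  by rewrite expf_eq0 mulf_eq0 (negPf nz_k) => /andP[_ /eqP].
move: dy; rewrite mulf_eq0 (negPf nz_x) expf_eq0 mulf_eq0 (negPf nz_k) /=.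
case/andP=> _ /eqP y0; move/eqP: dx.
rewrite y0 mulr0 (expr0n _ t) gtn_eqF // add0r mulf_eq0 (negPf nz_tk).
by rewrite expf_eq0 (negPf nz_x) andbF.
Qed.

Lemma meval_mderiv_mul_cone_branch n (F : comNzRingType) t i j m (k kappa : F)
    (x : 'I_n -> F) : (0 < t)%N ->
  ('X_m * cone_branch t k%:MP kappa%:MP 'X_j 'X_m)^`M(i).@[x]
  = (m == i)%:R * ((k * x j) ^+ t + kappa *+ t.+1 * x m ^+ t)
    + (j == i)%:R * (k * (x m * (k * x j) ^+ t.-1)) *+ t.
Proof.
move=> t_gt0.
have dX a : ('X_a : {mpoly F[n]})^`M(i).@[x] = (a == i)%:R.
  by rewrite mderivXU (rmorph_nat (meval x)).
rewrite (mderiv_mul_cone_branch _ _ _ _ _ t_gt0) mevalD mevalMn mevalM dX.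
rewrite [meval x (_ * (_ * _))]mevalM dX mevalD.
by rewrite !mevalM !(rmorphXn (meval x)) /= !mevalM !mevalC !mevalXU.
Qed.

Lemma meval_mderiv_node_cone (F : comNzRingType) t (c k l kappa : F) i
    (x : 'I_4 -> F) : (0 < t)%N ->
  (node_cone t c k l kappa)^`M(i).@[x]
  = ((lo 3 == i)%:R * ((k * x (lo 0)) ^+ t + kappa *+ t.+1 * x (lo 3) ^+ t)
     + (lo 0 == i)%:R * (k * (x (lo 3) * (k * x (lo 0)) ^+ t.-1)) *+ t)
  + c * ((lo 2 == i)%:R * ((l * x (lo 1)) ^+ t + kappa *+ t.+1 * x (lo 2) ^+ t)
     + (lo 1 == i)%:R * (l * (x (lo 2) * (l * x (lo 1)) ^+ t.-1)) *+ t).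
Proof.
move=> t_gt0; rewrite /node_cone /cone_equation [_ * (_%:MP * _)]mulrCA.
rewrite mderivD mderiv_mulC mevalD (mevalM x c%:MP) mevalC.
by congr (_ + _ * _); apply: meval_mderiv_mul_cone_branch.
Qed.

Lemma node_cone_smooth (R : realType) t (c k l kappa : R[i]) :
    (0 < t)%N -> c != 0 -> k != 0 -> l != 0 -> kappa != 0 ->
  smooth_hypersurface_equation (t + 1) (node_cone t c k l kappa).
Proof.
move=> t_gt0 nz_c nz_k nz_l nz_kappa; split.
  apply: (separable_fibre_hypersurface (x0 := fun i => (i == @Ordinal 3 0 isT)%:R)).
  - by rewrite addn1.
  - exact: node_cone_dhomog.
  - rewrite meval_node_cone /insert_last.
    have -> : unlift ord_max (lo 3) = None.
      by rewrite (_ : lo 3 = ord_max) ?unlift_none //; exact/val_inj.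
    have other (i : 'I_4) : (i < 3)%N ->
        (if unlift ord_max i is Some _ then 0 else 1) = 0 :> R[i].
      by case: unliftP => // ->; rewrite ltnn.
    rewrite !other // /cone_equation mul1r mul0r addr0 /cone_branch mulr0.
    by rewrite (expr0n _ t) gtn_eqF // add0r expr1n mulr1.
  - have -> : fibre (fun i => (i == @Ordinal 3 0 isT)%:R) (node_cone t c k l kappa)
        = 'X * ((k ^+ t)%:P + kappa *: 'X^t).
      rewrite fibre_node_cone /cone_equation /= !polyC0 mul0r addr0 /cone_branch.
      by rewrite polyC1 mulr1 polyC_exp mul_polyC.
    by apply: coprimep_binomial_deriv => //; rewrite expf_neq0.
move=> v [nz_v _ dv].
have t_eq0 : (t == 0)%N = false by rewrite gtn_eqF.
have E i := etrans (esym (meval_mderiv_node_cone c k l kappa i (v 0) t_gt0)) (dv i).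
have := E (lo 3); have := E (lo 2); have := E (lo 1); have := E (lo 0).
rewrite /= !(mul0r, mul1r, mul0rn, add0r, addr0, mulr0).
move=> /eqP; rewrite mulrn_eq0 t_eq0 mulf_eq0 (negPf nz_k) => /eqP dy.
move=> /eqP; rewrite mulf_eq0 (negPf nz_c) mulrn_eq0 t_eq0 mulf_eq0 (negPf nz_l) => /eqP dz.
move=> /eqP; rewrite mulf_eq0 (negPf nz_c) => /eqP dw du.
have [y0 u0] := cone_branch_smooth t_gt0 nz_k nz_kappa du dy.
have [z0 w0] := cone_branch_smooth t_gt0 nz_l nz_kappa dw dz.
case/eqP: nz_v; apply/rowP => j; rewrite mxE; case: j => -[|[|[|[|//]]]] ltj.
- by rewrite -[RHS]y0; congr (v 0 _); apply/val_inj.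
- by rewrite -[RHS]z0; congr (v 0 _); apply/val_inj.
- by rewrite -[RHS]w0; congr (v 0 _); apply/val_inj.
- by rewrite -[RHS]u0; congr (v 0 _); apply/val_inj.
Qed.

(** The linear part of ['X_i ^+ delta - 1] at [a] is [delta * a ^+ (delta - 1)
    * 'X_i]. When [delta = 1] the two powers of ['X_j] have the same degree
    and add up to [2 * 'X_j ^+ t]; otherwise the second is of higher order. *)
Lemma leading_form_branch n (A : comNzRingType) t delta (i j : 'I_n) (a : A) :
    (0 < t)%N -> (0 < delta)%N -> a ^+ delta = 1 ->
  leading_form t (branch t delta 1 ('X_i + a%:MP) 'X_j)
    (cone_branch t (a ^+ delta.-1 *+ delta)%:MP (if delta == 1%N then 2 else 1)%:MP 'X_i 'X_j).
Proof.
move=> t_gt0 d_gt0 ad; rewrite /branch /cone_branch !expr1n mulr1 -addrA.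
apply: leading_formD.
  have := leading_formX t (leading_form_expD i a delta).
  by rewrite ad mpolyC1 muln1.
have [->|d_neq1] := eqVneq delta 1%N.
  rewrite mul1n -mulr2n /= mpolyC_nat mulr_natl.
  by apply/leading_form_id/rpredMn/dhomogXn.
rewrite mpolyC1 mul1r -[X in leading_form _ _ X]addr0.
apply: leading_formD; first exact/leading_form_id/dhomogXn.
apply: leading_form_higher (leading_form_id (dhomogXn _ _ _)).
by rewrite -[X in (X < _)%N]mul1n ltn_mul2r t_gt0 /=; lia.
Qed.

Lemma tangent_cone_node (R : realType) t delta (c z : R[i]) (a : nat) :
    (0 < t)%N -> delta.-primitive_root z -> c != 0 ->
  exists k l kappa, [/\ k != 0, l != 0, kappa != 0
    & tangent_cone (threefold t delta c) (node delta z a) ord0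
      = node_cone t c k l kappa].
Proof.
move=> t_gt0 prim_z nz_c; have d_gt0 := prim_order_gt0 prim_z.
set b := z ^+ (a %/ delta); set b' := z ^+ (a %% delta).
have zd m : (z ^+ m) ^+ delta = 1 by rewrite exprAC (prim_expr_order prim_z) expr1n.
have nz_z m : z ^+ m != 0.
  by apply/eqP => zm; have /eqP := zd m; rewrite zm expr0n gtn_eqF // eq_sym oner_eq0.
pose kappa : R[i] := if delta == 1%N then 2 else 1.
have nz_kappa : kappa != 0 by rewrite /kappa; case: ifP; rewrite ?oner_eq0 // pnatr_eq0.
have nz_slope m : (z ^+ m) ^+ delta.-1 *+ delta != 0.
  by rewrite mulrn_eq0 gtn_eqF // expf_neq0.
exists (b ^+ delta.-1 *+ delta), (b' ^+ delta.-1 *+ delta), kappa.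
split; [exact: nz_slope | exact: nz_slope | exact: nz_kappa |].
rewrite /tangent_cone; apply: (@initial_formE _ _ (t + 1)); last first.
  have [[_ nz _ _] _] := node_cone_smooth t_gt0 nz_c (nz_slope (a %/ delta)%N)
    (nz_slope (a %% delta)%N) nz_kappa.
  exact: nz.
pose nd : 'rV[R[i]]_5 := node delta z a.
have localX j : 'X_j \mPo [tuple if unlift ord0 j is Some l
      then 'X_l + (nd 0 j / nd 0 ord0)%:MP else 1 | j < 5]
    = if unlift ord0 j is Some l then 'X_l + (nd 0 j / nd 0 ord0)%:MP_[4] else 1.
  by rewrite comp_mpolyXU -tnth_nth tnth_mktuple.
rewrite /local_equation /threefold (rmorph_equation (comp_mpoly _)) /=.
rewrite -/nd comp_mpolyC !localX.
(* The l-th local coordinate is the coordinate l + 1 of projective space. *)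
have toX (i : 'I_5) (l : 'I_4) : nat_of_ord i = l.+1 -> unlift ord0 i = Some l.
  by move=> Di; rewrite (_ : i = lift ord0 l) ?liftK //; apply/val_inj.
rewrite (toX (co 1) (lo 0)) // (toX (co 2) (lo 1)) // (toX (co 3) (lo 2)) //.
rewrite (toX (co 4) (lo 3)) // (_ : co 0 = ord0) ?unlift_none; last exact/val_inj.
rewrite !mxE /= !divr1 mpolyC0 !addr0 addnC.
have hX (l : 'I_4) : leading_form 1 ('X_l : {mpoly R[i][4]}) 'X_l.
  exact: (leading_form_id (dhomogXn _ _ 1)).
apply: leading_formD; apply: leading_formM => //; first exact: leading_form_branch.
rewrite -[t]add0n; apply: leading_formM; last exact: leading_form_branch.
by apply: leading_form_id; rewrite -[c%:MP]mulr1; exact/dhomogCM/dhomog1.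
Qed.

Lemma ordinary_node (R : realType) t delta (c z : R[i]) (a : nat) :
    (0 < t)%N -> delta.-primitive_root z -> c != 0 ->
  ordinary_point (t + 1) (threefold t delta c) (node delta z a).
Proof.
move=> t_gt0 prim_z nz_c.
have nd0 : node delta z a 0 ord0 != 0 by rewrite mxE oner_neq0.
have nz_nd : node delta z a != 0.
  by apply: contra_neq nd0 => ->; rewrite mxE.
have same : same_point (node delta z a) (node delta z a).
  by exists 1; rewrite ?oner_neq0 ?scale1r.
have [_ fv _] := singular_node c t_gt0 prim_z same nz_nd.
split=> //; exists ord0 => //.
have [k [l [kappa [nz_k nz_l nz_kappa ->]]]] := tangent_cone_node a t_gt0 prim_z nz_c.
exact: node_cone_smooth.
Qed.

(** * Existence *)

Theorem proposition6p1 (R : realType) (t delta : nat)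
    (t_gt0 : (0 < t)%N) (delta_gt0 : (0 < delta)%N) :
  exists (f : {mpoly R[i][5]}) (p : 'I_(delta ^ 2) -> 'rV[R[i]]_5),
    [/\ hypersurface_equation (delta * t + 1) f,
        ~ factorial_variety (zero_set f),
        (forall a b, same_point (p a) (p b) -> a = b),
        (forall v : 'rV[R[i]]_5, v != 0 ->
           (singular_point f v <-> exists a, same_point (p a) v))
      & forall a, ordinary_point (t + 1) f (p a)].
Proof.
have [z prim_z] := primitive_root_exists R[i] delta_gt0.
have [c nz_c generic] := weighted_sum_no_singularity R[i] t_gt0 delta_gt0.
exists (threefold t delta c), (fun a => node delta z a); split.
- exact: threefold_hypersurface.
- exact: threefold_not_factorial.
- by move=> a b; exact: node_inj prim_z.
- by move=> v nz_v; exact: (singular_threefold t_gt0 prim_z nz_c generic nz_v).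
- by move=> a; exact: ordinary_node.
Qed.
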